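(* Let $\varphi:\mathbb{R}^n\to[0,\infty)$ be a log-concave function (with the standing assumptions listed in the context). Then: (i) $\Omega_\varphi\le\left(\frac{as_\lambda(\varphi)}{\int\varphi\,dx}\right)^{\frac1\lambda}$ for all $\lambda>0$, and $\Omega_\varphi\ge\left(\frac{as_\lambda(\varphi)}{\int\varphi\,dx}\right)^{\frac1\lambda}$ for all $\lambda<0$. (ii) $\Omega_\varphi\,\Omega_{\varphi^\circ}\le1$. (iii) $\Omega_\varphi=\lim_{\alpha\to1}\left(\frac{as_\alpha(\varphi^\circ)}{\int\varphi\,dx}\right)^{\frac{1}{1-\alpha}}$. Equality holds in (i) and (ii) if $\varphi(x)=Ce^{-\langle Ax,x\rangle}$, where $C>0$ is a constant and $A$ is an $n\times n$ positive definite matrix.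
   Context: A function $\varphi:\mathbb{R}^n\to[0,\infty)$ is log-concave if $\varphi=e^{-\psi}$ with $\psi$ convex ($\psi:\mathbb{R}^n\to\mathbb{R}$); $\mathrm{supp}(\varphi)=\{x:\varphi(x)>0\}$. The dual function is $\varphi^\circ(x)=\inf_{y\in\mathbb{R}^n}\frac{e^{-\langle x,y\rangle}}{\varphi(y)}$. For $-\infty<\lambda<\infty$ the $L_\lambda$-affine surface area is $$as_\lambda(\varphi)=\int_{\mathrm{supp}(\varphi)}\varphi\left(\frac{e^{\langle\nabla\varphi,x\rangle/\varphi}}{\varphi^2}\det\left[\mathrm{Hess}(-\ln\varphi)\right]\right)^\lambda dx,$$ and $$\Omega_\varphi=\lim_{\lambda\downarrow0}\left(\frac{as_\lambda(\varphi)}{\int\varphi\,dx}\right)^{\frac1\lambda}$$ (the limit exists since $\lambda\mapsto(as_\lambda(\varphi)/\int\varphi\,dx)^{1/\lambda}$ is nonnegative and increasing on $\lambda>0$). The same definitions apply to $\varphi^\circ$. Standing assumptions: $\varphi$ and $\varphi^\circ$ are integrable and twice continuously differentiable on their supports, $-\ln\varphi$ is strictly convex, and the functions have enough smoothness and integrability that all the expressions considered make sense. *)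

(* Defs.v *)
From HB Require Import structures.
From mathcomp Require Import all_boot all_order all_algebra.
From mathcomp Require Import all_classical all_reals all_analysis.
Import Order.TTheory GRing.Theory Num.Theory.
Import numFieldNormedType.Exports.

Set Implicit Arguments.
Unset Strict Implicit.
Unset Printing Implicit Defensive.

Local Open Scope classical_set_scope.
Local Open Scope ring_scope.

Definition measure_rV_display : measure_display. Proof. exact. Qed.

(* The sigma-algebra generated by the coordinates, as the library does for
   tuples; it is the Borel sigma-algebra of R^n. *)
Section measurable_rV.
Context {R : realType} (n : nat).

Let coors : 'I_n -> 'rV[R]_n -> measurableTypeR R := fun i x => x ord0 i.

Let rV_set0 : g_sigma_preimage coors set0.
Proof. exact: sigma_algebra0. Qed.

Let rV_setC A : g_sigma_preimage coors A -> g_sigma_preimage coors (~` A).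
Proof. exact: sigma_algebraC. Qed.

Let rV_bigcup (F : (set 'rV[R]_n)^nat) :
  (forall i, g_sigma_preimage coors (F i)) ->
  g_sigma_preimage coors (\bigcup_i (F i)).
Proof. exact: sigma_algebra_bigcup. Qed.

HB.instance Definition _ := @isMeasurable.Build measure_rV_display
  'rV[R]_n (g_sigma_preimage coors) rV_set0 rV_setC rV_bigcup.

Lemma measurable_coor_rV (i : 'I_n) :
  measurable_fun [set: 'rV[R]_n] (coors i).
Proof.
move=> _ Y mY; rewrite setTI; apply: sub_sigma_algebra => /=.
rewrite -bigcup_seq/=; exists i => /=; first by rewrite mem_index_enum.
by exists Y => //; rewrite setTI.
Qed.

Lemma measurable_fun_rVP d (T : measurableType d) (f : T -> 'rV[R]_n) :
  measurable_fun [set: T] f <->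
  forall i, measurable_fun [set: T] (coors i \o f).
Proof.
split=> [mf i|mf]; first by apply: measurableT_comp => //; exact: measurable_coor_rV.
have : g_sigma_preimage (fun i => coors i \o f) `<=` measurable.
  apply: smallest_sub; first exact: sigma_algebra_measurable.
  move=> A; rewrite -bigcup_seq => -[i _ [B mB <-]].
  exact: mf.
by rewrite g_sigma_preimage_comp => sub _ A mA; apply: sub; exists A.
Qed.

End measurable_rV.

Section lebesgue_rV_step.
Context {R : realType} (n : nat).
Local Open Scope ereal_scope.

Definition cons_rV (p : measurableTypeR R * 'rV[R]_n) : 'rV[R]_n.+1 :=
  \row_i (if unlift ord0 i is Some j then p.2 ord0 j else p.1).

Definition uncons_rV (x : 'rV[R]_n.+1) : measurableTypeR R * 'rV[R]_n :=
  (x ord0 ord0, \row_j x ord0 (lift ord0 j)).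

Lemma cons_rVK : cancel cons_rV uncons_rV.
Proof.
move=> [t x]; rewrite /uncons_rV mxE unlift_none; congr pair.
by apply/rowP => j; rewrite !mxE liftK.
Qed.

Lemma measurable_cons_rV : measurable_fun setT cons_rV.
Proof.
apply/measurable_fun_rVP => i.
have [j ij|i0] := unliftP ord0 i.
  rewrite [X in measurable_fun _ X](_ : _ =
      (fun x : 'rV[R]_n => x ord0 j) \o snd).
    exact: measurableT_comp (measurable_coor_rV j) measurable_snd.
  by apply/funext => p /=; rewrite mxE ij liftK.
rewrite [X in measurable_fun _ X](_ : _ = fst); first exact: measurable_fst.
by apply/funext => p /=; rewrite mxE i0 unlift_none.
Qed.

Lemma measurable_uncons_rV : measurable_fun setT uncons_rV.
Proof.
apply/measurable_fun_pairP; split => /=; first exact: measurable_coor_rV.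
apply/measurable_fun_rVP => i.
rewrite [X in measurable_fun _ X](_ : _ =
    fun x : 'rV[R]_n.+1 => x ord0 (lift ord0 i)).
  exact: measurable_coor_rV.
by apply/funext => x /=; rewrite mxE.
Qed.

Variable m : {sigma_finite_measure set 'rV[R]_n -> \bar R}.

Definition prod_rV : set 'rV[R]_n.+1 -> \bar R :=
  pushforward (@lebesgue_measure R \x m) cons_rV.

Let prod_rV0 : prod_rV set0 = 0.
Proof. by rewrite /prod_rV /pushforward preimage_set0 measure0. Qed.

Let prod_rV_ge0 A : 0 <= prod_rV A.
Proof. by rewrite /prod_rV /pushforward measure_ge0. Qed.

Let prod_rV_sigma_additive : semi_sigma_additive prod_rV.
Proof.
move=> F mF tF mUF; rewrite /prod_rV /pushforward preimage_bigcup.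
have mcF k : measurable (cons_rV @^-1` F k).
  by rewrite -[X in measurable X]setTI; exact: measurable_cons_rV.
apply: measure_semi_sigma_additive => //.
  apply/trivIsetP => /= i j _ _ ij; rewrite -preimage_setI.
  by move/trivIsetP : tF => /(_ _ _ _ _ ij) ->//; rewrite preimage_set0.
exact: bigcup_measurable.
Qed.

HB.instance Definition _ := isMeasure.Build _ _ _ prod_rV
  prod_rV0 prod_rV_ge0 prod_rV_sigma_additive.

Let prod_rV_sigma_finite : sigma_finite setT prod_rV.
Proof.
have /sigma_finiteP[F [TF ndF mF]] :
  sigma_finite setT (@lebesgue_measure R) by exact: sigma_finiteT.
have /sigma_finiteP[G [TG ndG mG]] : sigma_finite setT m by exact: sigma_finiteT.
exists (fun k => uncons_rV @^-1` (F k `*` G k)) => [|k].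
  apply/esym; rewrite -subTset => x _.
  have [i _ Fi] : (\bigcup_i F i) (uncons_rV x).1 by rewrite -TF.
  have [j _ Gj] : (\bigcup_i G i) (uncons_rV x).2 by rewrite -TG.
  exists (maxn i j) => //; split.
    by move: Fi; apply/subsetPset/ndF/leq_maxl.
  by move: Gj; apply/subsetPset/ndG/leq_maxr.
have [mFk Fk] := mF k; have [mGk Gk] := mG k; split.
  rewrite -[X in measurable X]setTI; apply: measurable_uncons_rV => //.
  exact: measurableX.
rewrite /prod_rV /pushforward -comp_preimage.
rewrite (_ : uncons_rV \o cons_rV = id); last by apply/funext/cons_rVK.
by rewrite preimage_id product_measure1E// lte_mul_pinfty// ge0_fin_numE.
Qed.

HB.instance Definition _ :=
  Measure_isSigmaFinite.Build _ _ _ prod_rV prod_rV_sigma_finite.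

End lebesgue_rV_step.

(* n-dimensional Lebesgue measure, as an iterated product. *)
Fixpoint lebesgue_rV (R : realType) (n : nat) :
    {sigma_finite_measure set 'rV[R]_n -> \bar R} :=
  match n with
  | 0%N => \d_(0 : 'rV[R]_0)
  | k.+1 => prod_rV (lebesgue_rV R k)
  end.

Lemma lebesgue_rV_box (R : realType) n (A : 'I_n -> set (measurableTypeR R)) :
  (forall i, measurable (A i)) ->
  lebesgue_rV R n [set x | forall i, A i (x ord0 i)] =
  (\prod_i lebesgue_measure (A i))%E.
Proof.
elim: n A => [|n IHn] A mA.
  by rewrite big_ord0 /= diracE mem_set//= => -[].
rewrite big_ord_recl -IHn// -product_measure1E//=; last first.
  rewrite [X in measurable X](_ : _ = \bigcap_(i in [set` finset.setT])
      ((fun x : 'rV[R]_n => x ord0 i) @^-1` A (lift ord0 i))).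
    apply: fin_bigcap_measurable => // i _; rewrite -[X in measurable X]setTI.
    exact: measurable_coor_rV.
  by apply/seteqP; split => x /= Ax i; [move=> _; exact: Ax|apply: Ax; rewrite /= inE].
rewrite /prod_rV /pushforward; congr (_ _).
apply/seteqP; split => [[t x]/= Ax|[t x]/= [At Ax] i].
  split => [|j] /=; first by have := Ax ord0; rewrite mxE unlift_none.
  by have := Ax (lift ord0 j); rewrite mxE liftK.
by rewrite mxE; case: unliftP => [j ->|->]//; exact: Ax.
Qed.

Section functional_affine_surface_area.
Context {R : realType} {n : nat}.
Implicit Types (f : 'rV[R]_n -> R) (l : R).

Definition supp f : set 'rV[R]_n := [set x | 0 < f x].

Definition dotrV (x y : 'rV[R]_n) : R := (x *m y^T) ord0 ord0.

Definition log_concave f := exists psi : 'rV[R]_n -> R,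
  convex_function [set: convex_lmodType 'rV[R]_n] psi /\
  forall x, f x = expR (- psi x).

Definition strictly_convex f := forall (x y : 'rV[R]_n) (t : R),
  x != y -> 0 < t < 1 ->
  f (t *: x + (1 - t) *: y) < t * f x + (1 - t) * f y.

Definition dual f : 'rV[R]_n -> R :=
  fun x => inf [set expR (- dotrV x y) / f y | y in [set: 'rV[R]_n]].

Definition partial (i : 'I_n) f : 'rV[R]_n -> R := 'D_(delta_mx ord0 i) f.

Definition grad f x : 'rV[R]_n := \row_i partial i f x.

Definition hess f x : 'M[R]_n := \matrix_(i, j) partial i (partial j f) x.

(* Differentiability at x refers to a full neighbourhood of x in R^n, so this
   forces U to be open when U = supp f. *)
Definition C2_on (U : set 'rV[R]_n) f := forall x, U x ->
  [/\ differentiable f x,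
      forall i, differentiable (partial i f) x &
      forall i j, {for x, continuous (partial i (partial j f))}].

Definition total_integral f : \bar R :=
  (\int[lebesgue_rV R n]_x (f x)%:E)%E.

(* [0 `^ l = 0] for l < 0, but the base of the power is positive on the support
   as soon as the log-concave f and its dual are both C^2 on their supports:
   the two Hessians at corresponding points are then mutually inverse. *)
Definition affine_surface_area l f : \bar R :=
  (\int[lebesgue_rV R n]_(x in supp f)
    (f x * (expR (dotrV (grad f x) x / f x) / f x ^+ 2 *
            \det (hess (fun y => - ln (f y)) x)) `^ l)%:E)%E.

Definition posdef (A : 'M[R]_n) :=
  A^T = A /\ forall x : 'rV[R]_n, x != 0 -> 0 < dotrV (x *m A) x.

End functional_affine_surface_area.

(* Powers on [0, +oo]. Unlike poweR, (+oo)^r = 0 and 0^r = +oo when r < 0. *)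
Definition epow (R : realType) (x : \bar R) (r : R) : \bar R :=
  if r < 0 then ((x `^ (- r))^-1)%E else (x `^ r)%E.

(* The limit exists in [0, +oo] by monotonicity in l. *)
Definition Omega (R : realType) (n : nat) (f : 'rV[R]_n -> R) : \bar R :=
  lim (epow (affine_surface_area l f / total_integral f)%E l^-1
       @[l --> (0 : R)^'+]).

(* Main.v *)
Require Import Defs.
From mathcomp Require Import all_boot all_order all_algebra.
From mathcomp Require Import all_classical all_reals all_analysis.
From mathcomp Require Import measurable_realfun ring lra.
Import Order.TTheory GRing.Theory Num.Theory.
Import numFieldNormedType.Exports.

(** Write the log-concave function as [phi = exp (- psi)], let [T = grad psi]
    and let [psi*] be the Legendre conjugate of [psi], so that the dual function
    is [exp (- psi* )]. With the positive density
<<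
      g x = exp (2 psi x - <T x, x>) * det (Hess psi x)
>>
    the affine surface area of index [l] is the integral of [phi * g ^ l], and
    its normalization to the power [1 / l] is the power mean of exponent [l] of
    [g] for the probability of density proportional to [phi]. Three ingredients
    give the result.

    Power means. They increase with the exponent, across [0] as well: with
    [s = ln (g ^ m / c)], integrate the chord inequality between [exp (t * s)] and
    [1 - t + t * exp s], whose direction depends on the sign of [t]
    ([expR_chord_le], [expR_chord_ge]). Hence Omega, the limit at [0+], is the
    infimum of the means of positive exponent and bounds those of negative
    exponent, which is (i). If the integrals are finite near [0], expanding
    [exp (l * ln g)] to second order shows that the means of exponents [l] and
    [- l] are within a factor [1 + O(l)] of each other, so that the limit at [0]
    is two-sided ([cvg_power_mean_dnbhs]).

    Duality. The substitution [y = T x] turns the area of index [l] of the dual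
    function into the one of index [1 - l] of [phi]
    ([affine_surface_area_dual]): at [y = T x] the density of the dual function
    is [1 / g x], and [dual phi (T x) * det (Hess psi x) = phi x * g x] by
    Fenchel's equality. Together with the two-sided limit this is (iii). For
    (ii), Omega is at most the mean of exponent [1] for each of the two
    functions, and these two means are inverse ratios of the integrals of [phi]
    and of its dual. For a Gaussian, [g] is constant, so all power means agree,
    and those of [1 / g] are their inverses.

    Change of variables. [T] is a bijection from the whole space onto the open
    support of the dual function: a slope interior to the domain of [psi*] is
    attained by coercivity ([grad_surjective]), and the inverse is
    [S = grad psi*] since the supporting affine function at [T x] has slope [x]
    ([grad_dual_cancel]). As [S] is differentiable, the Hessian of [psi] is
    invertible, and its determinant, nonnegative by convexity, is positive.
    The formula itself ([integral_change_of_variables]) follows from a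
    Cousin-type induction on cubes ([cube_induction]): both sides are additive
    over subdivisions of a cube, so it is enough to compare them, up to a small
    multiple of the volume, on small cubes near each point. There [T] is squeezed
    between affine maps, whose effect on the volume is [lebesgue_rV_affine]. *)

Set Implicit Arguments.
Unset Strict Implicit.
Unset Printing Implicit Defensive.

Local Open Scope classical_set_scope.
Local Open Scope ring_scope.

(** * Lebesgue measure under affine maps *)

(** By uniqueness of the measure it suffices to consider half-open intervals; a
    negative [a] swaps their closed and open ends. *)
Lemma lebesgue_measure_affine (R : realType) (a b : R) (B : set R) :
  a != 0 -> measurable B ->
  (`|a|%:E * lebesgue_measure [set t | B (a * t + b)%R])%E = lebesgue_measure B.
Proof.
move=> a0 mB.
have mf : measurable_fun setT
    (fun t : measurableTypeR R => a * t + b : measurableTypeR R).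
  by apply: measurable_funD => //; exact: measurable_funM.
pose push := measure_function_pushforward__canonical__measure_function_Measure
  (@lebesgue_measure R) mf.
pose m := mscale (NngNum (normr_ge0 a)) push.
transitivity (m B); first by [].
apply/esym; apply: (lebesgue_measure_unique (mu := m)) => // _ [[x y] _ <-].
rewrite lebesgue_measure_itv /= lte_fin /m /mscale /push /= /pushforward.
have [a_gt0|a_lt0|] := ltrgtP a 0; last by move=> a00; rewrite a00 eqxx in a0.
- rewrite (_ : _ @^-1` _ = `[(y - b) / a, (x - b) / a[%classic); last first.
    apply/seteqP; split=> t /=; rewrite !in_itv/= => /andP[xt ty]; apply/andP.
      by rewrite ler_ndivrMr// ltr_ndivlMr// mulrC; split; lra.
    move: xt ty; rewrite ler_ndivrMr// ltr_ndivlMr// mulrC => xt ty; split; lra.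
  rewrite lebesgue_measure_itv /= lte_fin ltr_nM2r ?invr_lt0// ltrD2r.
  case: ifP => xy; last by rewrite mule0.
  rewrite ltr0_norm// -!EFinB -EFinM; congr EFin; field.
  by rewrite lt_eqF.
- rewrite (_ : _ @^-1` _ = `](x - b) / a, (y - b) / a]%classic); last first.
    apply/seteqP; split=> t /=; rewrite !in_itv/= => /andP[xt ty]; apply/andP.
      by rewrite ler_pdivlMr// ltr_pdivrMr// mulrC; split; lra.
    move: xt ty; rewrite ler_pdivlMr// ltr_pdivrMr// mulrC => xt ty; split; lra.
  rewrite lebesgue_measure_itv /= lte_fin ltr_pM2r ?invr_gt0// ltrD2r.
  case: ifP => xy; last by rewrite mule0.
  rewrite gtr0_norm// -!EFinB -EFinM; congr EFin; field.
  by rewrite gt_eqF.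
Qed.

Section affine_image.
Context {R : realType}.
Local Notation leb := (@lebesgue_measure R).
Local Open Scope ereal_scope.

Lemma cons_rVE n (t : R) (x : 'rV[R]_n) :
  cons_rV (t, x) = row_mx t%:M x :> 'rV[R]_(1 + n).
Proof.
apply/rowP => i; rewrite !mxE; case: splitP => j ij.
  have -> : i = ord0 by apply: val_inj; rewrite /= ij; case: j {ij} => -[].
  by rewrite unlift_none (ord1 j) mxE eqxx mulr1n.
have -> : i = lift ord0 j by apply: val_inj; rewrite /= ij.
by rewrite liftK.
Qed.

Lemma measurable_affine n (M : 'M[R]_n) (b : 'rV[R]_n) :
  measurable_fun setT (fun x : 'rV[R]_n => x *m M + b)%R.
Proof.
apply/measurable_fun_rVP => i; rewrite /comp/=.
under eq_fun do rewrite !mxE.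
apply: (@measurable_funD _ _ _ setT (fun x : 'rV[R]_n => \sum_j x ord0 j * M j i)%R
  (fun=> b ord0 i)) => //.
apply: measurable_sum => j; apply: measurable_funM => //.
exact: measurable_coor_rV.
Qed.

Lemma measurable_affine_preimage n (M : 'M[R]_n) (b : 'rV[R]_n) C :
  measurable C -> measurable [set x | C (x *m M + b)%R].
Proof.
by move=> mC; rewrite -[X in measurable X]setTI; exact: measurable_affine.
Qed.

Lemma lebesgue_rVS n C : measurable C -> lebesgue_rV R n.+1 C =
  \int[leb]_t lebesgue_rV R n [set x | C (cons_rV (t, x))].
Proof.
move=> mC; apply: eq_integral => t _ /=.
by rewrite xsectionE.
Qed.

(** The same measure with the order of integration reversed, so that the fibres
    are lines. *)
Lemma lebesgue_rVS_swap n C : measurable C -> lebesgue_rV R n.+1 C =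
  \int[lebesgue_rV R n]_x leb [set t | C (cons_rV (t, x))].
Proof.
move=> mC; transitivity ((leb \x^ lebesgue_rV R n) (@cons_rV R n @^-1` C)).
  apply: product_measure_unique.
    by move=> A B mA mB; exact: (@product_measure2E _ _ _ _ R leb (lebesgue_rV R n)).
  by rewrite -[X in measurable X]setTI; exact: measurable_cons_rV.
by apply: eq_integral => t _ /=; rewrite ysectionE.
Qed.


Lemma measurable_cons_xsection n t (C : set 'rV[R]_n.+1) :
  measurable C -> measurable [set x | C (cons_rV (t, x))].
Proof.
move=> mC; have := @measurable_cons_rV R n measurableT C mC.
by rewrite setTI => /(measurable_xsection t); rewrite xsectionE.
Qed.

Lemma measurable_cons_ysection n x (C : set 'rV[R]_n.+1) :
  measurable C -> measurable [set t : measurableTypeR R | C (cons_rV (t, x))].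
Proof.
move=> mC; have := @measurable_cons_rV R n measurableT C mC.
by rewrite setTI => /(measurable_ysection x); rewrite ysectionE.
Qed.

(** The map sends [(t, x)] to [(t, t c + x S + b)]: for fixed [t] it is affine
    with matrix [S], in one dimension less. *)
Let upper_step n (S : 'M[R]_n) (c b : 'rV[R]_n) (C : set 'rV[R]_n.+1) :
  (forall (b : 'rV[R]_n) C, measurable C ->
    `|\det S|%:E * lebesgue_rV R n [set x | C (x *m S + b)%R] = lebesgue_rV R n C) ->
  measurable C ->
  `|\det S|%:E * lebesgue_rV R n.+1
    [set x | C (x *m (block_mx 1%:M c 0 S : 'M[R]_(1 + n)) + row_mx 0 b)%R] =
  lebesgue_rV R n.+1 C.
Proof.
move=> IH mC.
have mD := measurable_affine_preimage (block_mx 1%:M c 0 S : 'M[R]_(1 + n))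
   (row_mx 0 b : 'rV[R]_(1 + n)) mC.
rewrite !lebesgue_rVS// -ge0_integralZl//; last first.
  have := @measurable_cons_rV R n measurableT _ mD.
  rewrite setTI => /(measurable_fun_xsection (lebesgue_rV R n)).
  by congr measurable_fun; apply/funext => t; rewrite /= xsectionE.
apply: eq_integral => t _.
rewrite -(IH (t *: c + b)%R _ (measurable_cons_xsection t mC)).
congr (_ * lebesgue_rV R n _); apply/seteqP; split=> x /=;
  rewrite !cons_rVE mul_row_block !mulmx0 mulmx1 addr0 add_row_mx addr0 mul_scalar_mx;
  by rewrite addrCA addrA.
Qed.

(** The map sends [(t, x)] to [(a t + x c + b, x)]: for fixed [x] it is an affine
    map of the line. *)
Let lower_step n (a b : R) (c : 'cV[R]_n) (C : set 'rV[R]_n.+1) :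
  a != 0%R -> measurable C ->
  `|a|%:E * lebesgue_rV R n.+1
    [set x | C (x *m (block_mx a%:M 0 c 1%:M : 'M[R]_(1 + n)) + row_mx b%:M 0)%R] =
  lebesgue_rV R n.+1 C.
Proof.
move=> a0 mC.
have mD := measurable_affine_preimage (block_mx a%:M 0 c 1%:M : 'M[R]_(1 + n))
   (row_mx b%:M 0 : 'rV[R]_(1 + n)) mC.
rewrite !lebesgue_rVS_swap// -ge0_integralZl//; last first.
  have := @measurable_cons_rV R n measurableT _ mD.
  rewrite setTI => /(measurable_fun_ysection (@lebesgue_measure R)).
  by congr measurable_fun; apply/funext => t; rewrite /= ysectionE.
apply: eq_integral => x _.
rewrite -(lebesgue_measure_affine ((x *m c) ord0 ord0 + b) a0 (measurable_cons_ysection x mC)).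
congr (_ * leb _); apply/seteqP; split=> t /=;
  rewrite !cons_rVE mul_row_block !mulmx0 mulmx1 add0r add_row_mx addr0;
  rewrite [(x *m c)%R]mx11_scalar -scalar_mxM -!raddfD/= [(t * a)%R]mulrC ?mxE addrA;
  by rewrite mulr1n.
Qed.

(** By induction on the dimension. A matrix with a nonzero pivot is the product
    of a lower and of an upper block triangular one, whose determinants are the
    pivot and the determinant of its Schur complement. *)
Theorem lebesgue_rV_affine n (M : 'M[R]_n) (b : 'rV[R]_n) (C : set 'rV[R]_n) :
  \det M != 0%R -> measurable C ->
  `|\det M|%:E * lebesgue_rV R n [set x | C (x *m M + b)%R] = lebesgue_rV R n C.
Proof.
elim: n M b C => [M b C _ mC|n IH].
  rewrite det_mx00 normr1 mul1e; congr (lebesgue_rV R 0 _).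
  by apply/seteqP; split=> x /=; rewrite (thinmx0 x) (thinmx0 (_ + b)%R).
rewrite -[n.+1]/(1 + n)%N.
have lshift0 : lshift n (0%R : 'I_1) = 0%R :> 'I_(1 + n) by exact: val_inj.
have pivot (M : 'M[R]_(1 + n)) (b : 'rV[R]_(1 + n)) (C : set 'rV[R]_(1 + n)) :
    M 0%R 0%R != 0%R -> \det M != 0%R -> measurable C ->
    `|\det M|%:E * lebesgue_rV R (1 + n) [set x | C (x *m M + b)%R] =
    lebesgue_rV R (1 + n) C.
  move=> a0 dM mC; set a := M 0%R 0%R in a0.
  pose u := (a^-1 *: ursubmx M)%R; pose S := (drsubmx M - dlsubmx M *m u)%R.
  pose L : 'M[R]_(1 + n) := block_mx a%:M 0 (dlsubmx M) 1%:M.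
  pose U : 'M[R]_(1 + n) := block_mx 1%:M u 0 S.
  have ML : M = (L *m U)%R.
    rewrite /L /U mulmx_block !mulmx1 !mulmx0 !mul0mx !addr0 !mul1mx.
    rewrite mul_scalar_mx scalerA divff// scale1r addrC subrK.
    rewrite -[LHS]submxK; congr block_mx.
    by rewrite [LHS]mx11_scalar !mxE !lshift0.
  have dL : \det L = a by rewrite det_lblock det_scalar1 det1 mulr1.
  have dU : \det U = \det S by rewrite det_ublock det1 mul1r.
  have dS : \det S != 0%R.
    by move: dM; rewrite ML det_mulmx dL dU mulf_eq0 negb_or => /andP[].
  pose b0 := lsubmx b 0%R 0%R; pose b' := (rsubmx b - b0 *: u)%R.
  pose D := [set x | C (x *m U + row_mx 0 b')%R].
  have mD : measurable D by exact: measurable_affine_preimage.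
  rewrite -(upper_step u b' (fun b C => IH S b C dS) mC) -/U -/D.
  rewrite -(lower_step b0 (dlsubmx M) a0 mD) muleA -EFinM -normrM.
  have xM x : (x *m M = x *m L *m U)%R by rewrite -mulmxA -ML.
  rewrite {1}ML det_mulmx dL dU [(a * _)%R]mulrC; congr (_ * lebesgue_rV R (1 + n) _).
  apply/seteqP; split=> x; rewrite /D /= -/L xM mulmxDl -addrA;
    rewrite [(row_mx _ _ *m U)%R]mul_row_block !mulmx0 mulmx1 mul0mx !addr0;
    rewrite add_row_mx addr0 mul_scalar_mx;
    by rewrite /b' [(_ + (_ - _))%R]addrC subrK -mx11_scalar hsubmxK.
move=> M b C dM mC.
have [a0|a0] := eqVneq (M 0%R 0%R) 0%R; last exact: pivot.
(* without a pivot, add a row with a nonzero first entry to the first row;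
   this is a volume preserving map of the upper triangular kind *)
have [k Mk] : exists k, M (rshift 1 k) 0%R != 0%R.
  apply/existsP; apply: contraNT dM; rewrite negb_exists => /forallP M0.
  rewrite (expand_det_col M 0%R) big1// => i _.
  case: (splitP i) => j ij.
    have -> : i = 0%R by apply: val_inj; rewrite /= ij; case: j {ij} => -[].
    by rewrite a0 mul0r.
  have -> : i = rshift 1 j by apply: val_inj.
  by have := M0 j; rewrite negbK => /eqP ->; rewrite mul0r.
pose E s : 'M[R]_(1 + n) := block_mx 1%:M (s *: delta_mx 0 k)%R 0 1%:M.
have EE : (E (-1) *m E 1)%R = 1%:M.
  rewrite /E mulmx_block !mulmx1 !mulmx0 !mul0mx !addr0 !mul1mx add0r.
  by rewrite scale1r scaleN1r subrr -scalar_mx_block.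
have dE s : \det (E s) = 1%R by rewrite det_ublock !det1 mulr1.
have E0 : (E 1 *m M)%R 0%R 0%R != 0%R.
  rewrite -{1}lshift0 -[M]vsubmxK /E mul_block_col !mul1mx scale1r col_mxEu mxE -rowE !mxE.
  by rewrite lshift0 a0 add0r.
pose D := [set x | C (x *m (E 1 *m M) + b)%R].
have mD : measurable D by exact: measurable_affine_preimage.
have dEM : \det (E 1 *m M)%R = \det M by rewrite det_mulmx dE mul1r.
rewrite -(pivot _ b C E0 _ mC) dEM// -/D.
have : `|\det (1%:M : 'M[R]_n)|%:E * lebesgue_rV R (1 + n)
  [set x | D (x *m E (-1) + row_mx 0 0)%R] = lebesgue_rV R (1 + n) D.
  by apply: upper_step => // b1 C1 mC1; apply: IH => //; rewrite det1 oner_eq0.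
rewrite det1 normr1 mul1e => <-; congr (_ * lebesgue_rV R (1 + n) _).
apply/seteqP; split=> x; rewrite /D /= row_mx0 addr0 !mulmxA;
  by rewrite -[(x *m _ *m E 1)%R]mulmxA EE mulmx1.
Qed.

End affine_image.

(** * Cubes and Borel sets *)

Section rV_norm.
Context {R : realType} {n : nat}.
Implicit Types x y : 'rV[R]_n.

Lemma coord_le_norm x i : `|x ord0 i| <= `|x|.
Proof.
rewrite [leRHS]/Num.Def.normr /= mx_normrE.
exact: (le_bigmax _ (fun ij : 'I_1 * 'I_n => `|x ij.1 ij.2|) (ord0, i)).
Qed.

Lemma rV_norm_le x e : 0 <= e -> (forall i, `|x ord0 i| <= e) -> `|x| <= e.
Proof.
move=> e0 xe; rewrite [leLHS]/Num.Def.normr /= mx_normrE; apply: bigmax_le => // -[i j] _ /=.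
by rewrite (ord1 i).
Qed.

Lemma rV_norm_lt x e : 0 < e -> (forall i, `|x ord0 i| < e) -> `|x| < e.
Proof.
move=> e0 xe; rewrite [ltLHS]/Num.Def.normr /= mx_normrE; apply/bigmax_ltP.
split => // -[i j] _ /=.
by rewrite (ord1 i).
Qed.

(** Half-open cubes, so that the halved cubes of a cube partition it. *)
Definition cube (a : 'rV[R]_n) (r : R) : set 'rV[R]_n :=
  [set x | forall i, a ord0 i <= x ord0 i < a ord0 i + r].

Lemma cube_boxE a r :
  cube a r = [set x | forall i, `[a ord0 i, a ord0 i + r[%classic (x ord0 i)].
Proof. by apply/seteqP; split => x /= ax i; have := ax i; rewrite /= in_itv. Qed.

Lemma measurable_cube a r : measurable (cube a r).
Proof.
rewrite cube_boxE [X in measurable X](_ : _ = \bigcap_(i in [set` finset.setT])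
    ((fun x : 'rV[R]_n => x ord0 i) @^-1` `[a ord0 i, a ord0 i + r[%classic)).
  apply: fin_bigcap_measurable => // i _; rewrite -[X in measurable X]setTI.
  by apply: measurable_coor_rV => //; exact: measurable_itv.
by apply/seteqP; split => x /= Ax i; [move=> _; exact: Ax|apply: Ax; rewrite /= inE].
Qed.

Lemma lebesgue_cube a r : 0 <= r -> lebesgue_rV R n (cube a r) = (r ^+ n)%:E.
Proof.
move=> r0; rewrite cube_boxE.
rewrite (@lebesgue_rV_box R n (fun i => `[a ord0 i, a ord0 i + r[%classic)); last first.
  by move=> i; exact: measurable_itv.
under eq_bigr => i _.
  rewrite lebesgue_measure_itv /= lte_fin ltrDl -EFinB.
  rewrite (_ : (if _ then _ else _) = r%:E); first over.
  have [r_gt0|] := ltP 0 r; first by rewrite [X in X%:E]addrC addKr.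
  by move=> r_le0; congr EFin; apply/le_anti/andP.
by rewrite prodEFin prodr_const card_ord.
Qed.

Lemma cube_sub_ball a r x y : cube a r x -> cube a r y -> 0 < r -> `|x - y| < r.
Proof.
move=> ax ay r0; apply: rV_norm_lt => // i; rewrite !mxE ltr_norml.
by have /andP[? ?] := ax i; have /andP[? ?] := ay i; lra.
Qed.

(** An open set is the union of the countably many cubes with a rational corner
    and side [1 / k] that it contains. *)
Lemma open_measurable_rV (U : set 'rV[R]_n) : open U -> measurable U.
Proof.
move=> oU; pose F (q : 'rV[rat]_n * nat) : set 'rV[R]_n :=
  let c := cube (map_mx ratr q.1) (q.2.+1%:R^-1) in
  if `[< c `<=` U >] then c else set0.
rewrite (_ : U = \bigcup_q F q); last first.
  apply/seteqP; split=> [x Ux|x [q _]]; last first.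
    by rewrite /F; case: ifPn => // /asboolP + /= => /[apply].
  have /nbhs_ballP[e /= e0 xeU] := open_nbhs_nbhs (conj oU Ux).
  pose k := Num.truncn e^-1.
  have ke : k.+1%:R^-1 < e by rewrite invf_plt ?posrE//; exact: truncnS_gt.
  have q_ex i : exists q : rat, x ord0 i - k.+1%:R^-1 < ratr q < x ord0 i.
    have [|q] := @rat_in_itvoo R (x ord0 i - k.+1%:R^-1) (x ord0 i).
      by rewrite ltrBlDr ltrDl invr_gt0.
    by rewrite in_itv /=; exists q.
  pose q := \row_i sval (cid (q_ex i)).
  have xq : cube (map_mx ratr q) (k.+1%:R^-1) x.
    move=> i; rewrite !mxE; case: cid => /= ? /andP[xq qx].
    by rewrite (ltW qx) -ltrBlDr.
  exists (q, k) => //; rewrite /F /= asboolT// => y qy; apply: xeU.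
  rewrite -ball_normE /=; apply: lt_trans ke.
  by apply: cube_sub_ball xq qy _; rewrite invr_gt0.
apply: countable_bigcupT_measurable; first exact: countableP.
by move=> q; rewrite /F; case: ifPn => _; [exact: measurable_cube|exact: measurable0].
Qed.

Lemma continuous_measurable_rV (D : set 'rV[R]_n) (f : 'rV[R]_n -> R) :
  open D -> (forall x, D x -> {for x, continuous f}) -> measurable_fun D f.
Proof.
move=> oD cf; apply: (measurability _ (RGenOpens.measurableE R)).
move=> _ [_ [a [b ->] <-]]; apply: open_measurable_rV.
rewrite openE => x [Dx fx]; rewrite /interior.
apply: filterI; first exact: open_nbhs_nbhs.
by apply: cf => //; exact: open_nbhs_nbhs.
Qed.

End rV_norm.

(** * Induction on cubes *)

Section bisection.
Context {R : realType} {n : nat}.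
Implicit Types (a x : 'rV[R]_n) (r : R) (e : {ffun 'I_n -> bool}).

Definition half_corner a r e : 'rV[R]_n := \row_i (a ord0 i + (e i)%:R * (r / 2)).

Lemma cube_halves a r :
  cube a r = \bigcup_e cube (half_corner a r e) (r / 2).
Proof.
apply/seteqP; split => [x ax|x [e _ ex] i].
  exists [ffun i => a ord0 i + r / 2 <= x ord0 i] => // i.
  rewrite !mxE ffunE; have /andP[? ?] := ax i.
  by case: (leP (a ord0 i + r / 2) (x ord0 i)) => /= h; apply/andP; split; lra.
have := ex i; rewrite mxE => /andP[].
have [er|] := leP 0 r; first by case: (e i) => /= ? ?; apply/andP; split; lra.
by case: (e i) => /= ? ? ?; exfalso; lra.
Qed.

Lemma trivIset_cube_halves a r :
  trivIset [set: {ffun 'I_n -> bool}] (fun e => cube (half_corner a r e) (r / 2)).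
Proof.
apply/trivIsetP => e f _ _ ef; apply/seteqP; split => // x [ex fx].
have [i] : exists i, e i != f i.
  apply/existsP; apply: contraNT ef; rewrite negb_exists => /forallP ef.
  by apply/eqP/ffunP => i; have := ef i; rewrite negbK => /eqP.
have := ex i; have := fx i; rewrite !mxE.
by case: (e i); case: (f i) => //= /andP[? ?] /andP[? ?] _; lra.
Qed.

Lemma ge0_integral_cube_halves d (X : measurableType d)
    (m : {measure set X -> \bar R}) (D : set X) (S : X -> 'rV[R]_n)
    (f : X -> \bar R) a r :
  measurable D -> (forall a r, measurable (D `&` S @^-1` cube a r)) ->
  measurable_fun D f -> (forall y, D y -> (0 <= f y)%E) ->
  (\int[m]_(y in D `&` S @^-1` cube a r) f y =
   \sum_e \int[m]_(y in D `&` S @^-1` cube (half_corner a r e) (r / 2)) f y)%E.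
Proof.
move=> mD mDS mf f0.
pose F e := D `&` S @^-1` cube (half_corner a r e) (r / 2).
have UF : D `&` S @^-1` cube a r = \big[setU/set0]_(e <- index_enum _) F e.
  rewrite -bigcup_seq cube_halves preimage_bigcup setI_bigcupr.
  by apply/seteqP; split => x [e _ ?]; exists e => //=; rewrite mem_index_enum.
have FD : \big[setU/set0]_(e <- index_enum _) F e `<=` D by rewrite -UF => x [].
rewrite UF ge0_integral_bigsetU//.
- by move=> e; exact: mDS.
- exact: index_enum_uniq.
- apply: (@sub_trivIset _ _ _ setT) => //; apply/trivIsetP => e f' _ _ ef.
  have /trivIsetP/(_ e f' Logic.I Logic.I ef) := @trivIset_cube_halves a r.
  by rewrite /F setIACA -preimage_setI => ->; rewrite preimage_set0 setI0.
- exact: measurable_funS mf.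
- by move=> y /FD; exact: f0.
Qed.

(** Cousin's lemma for cubes: a cube violating [P] has a half violating [P],
    and the point common to the resulting nested cubes contradicts the local
    validity of [P] there. *)
Lemma cube_induction (P : 'rV[R]_n -> R -> Prop) :
  (forall a r, 0 < r -> (forall e, P (half_corner a r e) (r / 2)) -> P a r) ->
  (forall x, exists2 d, 0 < d & forall a r, 0 < r < d ->
     (forall i, a ord0 i <= x ord0 i <= a ord0 i + r) -> P a r) ->
  forall a r, 0 < r -> P a r.
Proof.
move=> Pglue Ploc a r r0; apply: contrapT => nPar.
have bad_half (q : 'rV[R]_n * R) : exists e, 0 < q.2 -> ~ P q.1 q.2 ->
    ~ P (half_corner q.1 q.2 e) (q.2 / 2).
  have [all|/existsNP[e nPe]] := pselect (forall e, P (half_corner q.1 q.2 e) (q.2 / 2)).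
    by exists [ffun=> false] => q0; move/(_ (Pglue _ _ q0 all)).
  by exists e.
pose next (q : 'rV[R]_n * R) :=
  (half_corner q.1 q.2 (sval (cid (bad_half q))), q.2 / 2).
pose u k := iter k next (a, r).
have u2 k : (u k).2 = r / 2 ^+ k.
  elim: k => [|k IH]; first by rewrite expr0 divr1.
  by rewrite /= IH exprSr invfM mulrA.
have u2_gt0 k : 0 < (u k).2 by rewrite u2 divr_gt0// exprn_gt0.
have nPu k : ~ P (u k).1 (u k).2.
  elim: k => [//|k IH] /=; case: cid => e /= he.
  exact: he (u2_gt0 k) IH.
have nested k i : (u k).1 ord0 i <= (u k.+1).1 ord0 i /\
    (u k.+1).1 ord0 i + (u k.+1).2 <= (u k).1 ord0 i + (u k).2.
  rewrite [u k.+1]/= -/(u k) /= mxE; set e := sval _; have := u2_gt0 k.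
  by case: (e i) => /=; split; lra.
have nested_le k m i : (k <= m)%N -> (u k).1 ord0 i <= (u m).1 ord0 i /\
    (u m).1 ord0 i + (u m).2 <= (u k).1 ord0 i + (u k).2.
  elim: m => [|m IH]; first by rewrite leqn0 => /eqP ->.
  rewrite leq_eqVlt => /predU1P[->//|]; rewrite ltnS => /IH[h1 h2].
  by have [h3 h4] := nested m i; split; [exact: le_trans h1 h3|exact: le_trans h4 h2].
pose A i := [set (u k).1 ord0 i | k in [set: nat]].
pose x : 'rV[R]_n := \row_i sup (A i).
have ubA m i : ubound (A i) ((u m).1 ord0 i + (u m).2).
  move=> _ [k _ <-]; have [km|mk] := leqP k m.
    by have [h1 _] := nested_le k m i km; have := u2_gt0 m; lra.
  by have [_ h1] := nested_le m k i (ltnW mk); have := u2_gt0 k; lra.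
have ux m i : (u m).1 ord0 i <= x ord0 i <= (u m).1 ord0 i + (u m).2.
  rewrite mxE; apply/andP; split.
    by apply: ub_le_sup; [exists ((u 0%N).1 ord0 i + (u 0%N).2); exact: ubA|exists m].
  by apply: ge_sup; [exists ((u 0%N).1 ord0 i); exists 0%N|exact: ubA].
have [d d0 Pd] := Ploc x.
pose k := (Num.truncn (r / d)).+1.
apply: (nPu k); apply: Pd; last exact: ux.
rewrite u2_gt0 u2 ltr_pdivrMr ?exprn_gt0// mulrC -ltr_pdivrMr//.
apply: (lt_trans (truncnS_gt _)); rewrite -/k -natrX ltr_nat.
exact: ltn_expl.
Qed.

End bisection.

(** * Change of variables *)

Lemma continuous_atP (R : realType) n (W : pseudoMetricNormedZmodType R)
    (f : 'rV[R]_n -> W) x :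
  {for x, continuous f} <-> forall e : R, 0 < e -> exists2 d, 0 < d &
    forall z, `|z - x| < d -> `|f z - f x| <= e.
Proof.
have [fP1 fP2] := @cvgrPdist_le R _ _ (nbhs x) _ f (f x); split=> [cf e e0|cf].
  have [d /= d0 xd] := (nbhs_normP x _).1 (fP1 cf e e0); exists d => // z zx.
  by rewrite distrC; apply: xd; rewrite /ball_ /= distrC.
apply: fP2 => e /cf[d d0 xd]; apply: (nbhs_normP x _).2; exists d => //= z.
rewrite /ball_ /= => zx; by rewrite distrC; apply: xd; rewrite distrC.
Qed.

Lemma mulmx_bound (R : realType) n (M : 'M[R]_n) :
  exists2 k : R, 0 < k & forall v : 'rV[R]_n, `|v *m M| <= k * `|v|.
Proof.
pose k := 1 + \sum_i \sum_j `|M i j|.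
have s0 : 0 <= \sum_i \sum_j `|M i j| by do 2 apply: sumr_ge0 => ? _.
exists k => [|v]; first by rewrite /k; lra.
apply: rV_norm_le => [|j]; first by rewrite mulr_ge0//; rewrite /k; lra.
rewrite mxE; apply: le_trans (ler_norm_sum _ _ _) _.
apply: (@le_trans _ _ (\sum_i `|M i j| * `|v|)).
  by apply: ler_sum => i _; rewrite normrM mulrC ler_wpM2l// coord_le_norm.
rewrite -mulr_suml ler_wpM2r// /k -[leLHS]add0r lerD//; apply: ler_sum => i _.
by rewrite (bigD1 j)//= lerDl; apply: sumr_ge0.
Qed.

(** [J] is the Frechet derivative of [T] at [x], acting on row vectors. *)
Definition frechet_at (R : realType) n (T : 'rV[R]_n -> 'rV[R]_n) x (J : 'M[R]_n) :=
  forall e : R, 0 < e -> exists2 d, 0 < d &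
    forall v, `|v| < d -> `|T (x + v) - T x - v *m J| <= e * `|v|.

Lemma frechet_continuous (R : realType) n (T : 'rV[R]_n -> 'rV[R]_n) x J :
  frechet_at T x J -> {for x, continuous T}.
Proof.
move=> dT; have [k k0 kJ] := mulmx_bound J.
have [d d0 Td] := dT 1 ltr01.
apply/continuous_atP => e e0.
pose d' := Num.min d (e / (1 + k)).
exists d' => [|z]; first by rewrite /d' lt_min d0 divr_gt0// addr_gt0.
rewrite lt_min -[in `|T z - _|](subrKC x z); set v := z - x => /andP[vd vk].
have := Td _ vd; rewrite mul1r => Tv.
rewrite -[T _ - _](subrK (v *m J)).
apply: le_trans (ler_normD _ _) _; apply: le_trans (lerD Tv (kJ v)) _.
by rewrite -{1}[`|v|]mul1r -mulrDl mulrC -ler_pdivlMr ?addr_gt0// ltW.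
Qed.

Section change_of_variables.
Context {R : realType} {n : nat}.
Local Notation leb := (lebesgue_rV R n).
Implicit Types x y z v w : 'rV[R]_n.

Lemma lebesgue_affine_preimage (M : 'M[R]_n) b C :
  \det M != 0 -> measurable C ->
  leb [set w | C (w *m invmx M + b)] = (`|\det M|%:E * leb C)%E.
Proof.
move=> dM mC.
have dV : \det (invmx M) != 0 by rewrite det_inv invr_neq0.
rewrite -(lebesgue_rV_affine b dV mC) det_inv normfV muleA -EFinM.
by rewrite divff ?mul1e// normr_eq0.
Qed.

Lemma integral_cst_cube (c r : R) a : 0 <= r ->
  (\int[leb]_(x in cube a r) c%:E = (c * r ^+ n)%:E)%E.
Proof.
move=> r0; rewrite integral_cst; last exact: measurable_cube.
by rewrite [X in (_ * X)%E]lebesgue_cube.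
Qed.

Variables (T S : 'rV[R]_n -> 'rV[R]_n) (V : set 'rV[R]_n).
Variables (J : 'rV[R]_n -> 'M[R]_n) (h : 'rV[R]_n -> R).
Hypotheses (oV : open V) (TV : forall x, V (T x)) (TK : cancel T S)
  (SK : forall y, V y -> T (S y) = y).
Hypotheses (dT : forall x, frechet_at T x (J x))
  (dS : forall x, frechet_at S (T x) (invmx (J x)))
  (cS : forall y, V y -> {for y, continuous S})
  (J_gt0 : forall x, 0 < \det (J x))
  (cJ : continuous (fun x => \det (J x))).
Hypotheses (h_ge0 : forall y, V y -> 0 <= h y)
  (ch : forall y, V y -> {for y, continuous h}).

Let F x := h (T x) * \det (J x).

Let cF : continuous F.
Proof.
move=> x; apply: (@continuousM _ _ (h \o T)); last exact: cJ.
apply: continuous_comp; first exact: frechet_continuous (dT x).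
by apply: ch.
Qed.

Let F_ge0 x : 0 <= F x.
Proof. by rewrite mulr_ge0 ?h_ge0// ltW. Qed.

Let L x z := T x + (z - x) *m J x.
Let Li x w := (w - T x) *m invmx (J x) + x.

Let J_unit x : J x \in unitmx.
Proof. by rewrite unitmxE unitfE gt_eqF. Qed.

Let LiK x w : L x (Li x w) = w.
Proof. by rewrite /L /Li addrK mulmxKV// subrKC. Qed.

(** [L x] is the affine approximation of [T] at [x] and [Li x] its inverse: both
    [Li x \o T] and [S \o L x] are tangent to the identity at [x]. *)
Let near_derivative x (e : R) : 0 < e -> exists2 d, 0 < d & forall z, `|z - x| < d ->
  [/\ `|Li x (T z) - z| <= e * `|z - x|,
      V (L x z), `|S (L x z) - z| <= e * `|z - x|,
      `|h (T z) - h (T x)| <= e & `|F z - F x| <= e].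
Proof.
move=> e0.
have [k k0 kJ] := mulmx_bound (J x); have [k' k'0 kJi] := mulmx_bound (invmx (J x)).
have [d1 d10 H1] := dT x (divr_gt0 e0 k'0).
have [d2 d20 H2] := dS x (divr_gt0 e0 k0).
have /nbhs_normP[d3 /= d30 H3] : nbhs (T x) V by apply: open_nbhs_nbhs.
have chT : {for x, continuous (h \o T)}.
  apply: continuous_comp; first exact: frechet_continuous (dT x).
  exact: ch.
have [d4 d40 H4] := (continuous_atP _ _).1 chT e e0.
have [d5 d50 H5] := (continuous_atP _ _).1 (@cF x) e e0.
pose d := Num.min (Num.min d1 (Num.min (d2 / k) (d3 / k))) (Num.min d4 d5).
exists d => [|z]; first by rewrite !lt_min d10 d40 d50 !divr_gt0.
rewrite !lt_min => /andP[/and3P[z1 z2 z3] /andP[z4 z5]].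
have kz : `|(z - x) *m J x| <= k * `|z - x| by exact: kJ.
split.
- have -> : Li x (T z) - z = (T z - T x - (z - x) *m J x) *m invmx (J x).
    by rewrite [RHS]mulmxBl mulmxK// /Li opprB addrA addrAC.
  apply: le_trans (kJi _) _; rewrite mulrC -ler_pdivlMr//.
  by have := H1 _ z1; rewrite subrKC mulrAC.
- apply: H3; rewrite /ball_ /= /L opprD addNKr normrN.
  by apply: le_lt_trans kz _; rewrite mulrC -ltr_pdivlMr.
- have := H2 ((z - x) *m J x); rewrite mulmxK// TK.
  have -> : S (L x z) - z = S (T x + (z - x) *m J x) - x - (z - x).
    by rewrite /L opprB addrA subrK.
  move=> /(_ _)/le_trans -> //.
    by apply: le_lt_trans kz _; rewrite mulrC -ltr_pdivlMr.
  by rewrite mulrAC ler_pdivrMr// -mulrA ler_pM2l// mulrC.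
- exact: H4.
- exact: H5.
Qed.


Let mVS a r : measurable (V `&` S @^-1` cube a r).
Proof.
rewrite cube_boxE (_ : _ `&` _ = V `&` \bigcap_(i in [set` finset.setT])
    (V `&` (fun y => S y ord0 i) @^-1` `[a ord0 i, a ord0 i + r[%classic)); last first.
  apply/seteqP; split => [y [Vy Sy]|y [Vy Sy]]; split => //.
    by move=> i _; split => //; exact: Sy.
  by move=> i; apply: (Sy i _).2; rewrite /= inE.
have mV := open_measurable_rV oV.
apply: measurableI => //; apply: fin_bigcap_measurable => // i _.
have mS : measurable_fun V (fun y => S y ord0 i).
  apply: continuous_measurable_rV => // y Vy.
  apply: (@continuous_comp _ _ _ S (fun z => z ord0 i)); first exact: cS.
  exact: coord_continuous.
by apply: mS => //; exact: measurable_itv.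
Qed.

Let mh : measurable_fun V (EFin \o h).
Proof. by apply/measurable_EFinP; exact: continuous_measurable_rV. Qed.

Let mF D : measurable_fun D (EFin \o F).
Proof.
apply/measurable_EFinP; apply: measurable_funTS.
by apply: continuous_measurable_rV => [|x _]; [exact: openT|exact: cF].
Qed.

(** Room for the errors made on a small cube around [x]: [u] bounds the relative
    displacement of its points and the oscillation of [h] and [F]. *)
Let margin x (e : R) : 0 < e -> exists u, [/\ 0 < u < 4^-1, u <= e / 2,
  (h (T x) + u) * (\det (J x) * (1 + 2 * u) ^+ n) <= F x + e / 2 &
  F x - e / 2 <= (h (T x) - u) * (\det (J x) * (1 - 2 * u) ^+ n)].
Proof.
move=> e0; set h0 := h _; set d0 := \det _.
pose p s u : R := (h0 + s * u) * (d0 * (1 + 2 * s * u) ^+ n).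
have cp s : {for 0, continuous (p s)}.
  pose q := (h0%:P + s *: 'X) * (d0 *: (1 + (2 * s) *: 'X) ^+ n).
  have -> : p s = horner q by apply/funext => u; rewrite /q /p !hornerE.
  exact: continuous_horner.
have pE s : p s 0 = F x by rewrite /p !mulr0 !addr0 expr1n mulr1.
have e2 : 0 < e / 2 by rewrite divr_gt0.
have near_p s : \forall u \near (0 : R)^'+, `|F x - p s u| <= e / 2.
  have [cvgp _] := @cvgrPdist_le R R _ (nbhs 0) _ (p s) (p s 0).
  by have := cvgp (cp s) _ e2; rewrite pE; exact: cvg_at_right_filter.
near (0 : R)^'+ => u; exists u.
have u0 : 0 < u by [].
have u4 : u < 4^-1 by near: u; apply: nbhs_right_lt; rewrite invr_gt0.
have ue : u <= e / 2 by near: u; exact: nbhs_right_le.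
have p1 : `|F x - p 1 u| <= e / 2 by near: u; exact: near_p.
have p2 : `|F x - p (-1) u| <= e / 2 by near: u; exact: near_p.
move: p1 p2; rewrite /p mulr1 !mul1r mulN1r mulrN1 mulNr !ler_norml.
by move=> /andP[p1 _] /andP[_ p2]; split => //; [rewrite u0 u4|lra|lra].
Unshelve. all: by end_near. Qed.


Let leb_Li x a r : 0 <= r ->
  leb [set w | cube a r (Li x w)] = (\det (J x) * r ^+ n)%:E.
Proof.
move=> r0; rewrite (_ : mkset _ =
    [set w | cube a r (w *m invmx (J x) + (x - T x *m invmx (J x)))]); last first.
  by apply/seteqP; split => w; rewrite /= /Li mulmxBl addrAC addrA.
rewrite lebesgue_affine_preimage ?gt_eqF//; last exact: measurable_cube.
by rewrite [X in (_ * X)%E]lebesgue_cube// gtr0_norm.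
Qed.

Let mLi x a r : measurable [set w | cube a r (Li x w)].
Proof.
rewrite (_ : mkset _ =
    [set w | cube a r (w *m invmx (J x) + (x - T x *m invmx (J x)))]); last first.
  by apply/seteqP; split => w; rewrite /= /Li mulmxBl addrAC addrA.
exact: (measurable_affine_preimage (invmx (J x)) (x - T x *m invmx (J x))
  (measurable_cube a r)).
Qed.

(** For small cubes near [x], the preimage under [S] is squeezed between the
    images of slightly shrunk and enlarged cubes under the affine map [L x]. *)
Let local_estimate x (e : R) : 0 < e -> exists2 d : R, 0 < d &
  forall (a : 'rV[R]_n) (r : R), 0 < r < d ->
  (forall i, a ord0 i <= x ord0 i <= a ord0 i + r) ->
  (\int[leb]_(y in V `&` S @^-1` cube a r) (h y)%:E <=
   \int[leb]_(z in cube a r) (F z + e)%:E)%E /\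
  (\int[leb]_(z in cube a r) (F z)%:E <=
   \int[leb]_(y in V `&` S @^-1` cube a r) (h y)%:E +
   \int[leb]_(z in cube a r) e%:E)%E.
Proof.
move=> e0; have [u [/andP[u0 u4] ue pU pL]] := margin x e0.
have [d d0 H] := near_derivative x u0.
exists d => // a r /andP[r0 rd] ax.
set h0 := h (T x) in pU pL; set D := \det (J x) in pU pL.
have D0 : 0 < D by exact: J_gt0.
have h00 : 0 <= h0 by exact: h_ge0.
have mQ := measurable_cube a r.
have mV := open_measurable_rV oV.
have le_r z : cube a r z -> `|z - x| <= r.
  move=> az; apply: rV_norm_le => [|i]; first exact: ltW.
  rewrite !mxE ler_norml; have /andP[? ?] := az i; have /andP[? ?] := ax i.
  by apply/andP; split; lra.
have ur0 : 0 < u * r by exact: mulr_gt0.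
have ur4 : u * r < r / 4 by rewrite mulrC ltr_pM2l.
have Hr z : `|z - x| <= r ->
  [/\ `|Li x (T z) - z| <= u * r, V (L x z), `|S (L x z) - z| <= u * r,
      `|h (T z) - h (T x)| <= u & `|F z - F x| <= u].
  move=> zr; have [H1 H2 H3 H4 H5] := H z (le_lt_trans zr rd).
  have zur : u * `|z - x| <= u * r by rewrite ler_pM2l.
  by split => //; [exact: le_trans H1 zur|exact: le_trans H3 zur].
have mhS : measurable_fun (V `&` S @^-1` cube a r) (EFin \o h).
  by apply: measurable_funS mh => // y [].
split.
- pose W := [set w | cube (a - const_mx (u * r)) (r * (1 + 2 * u)) (Li x w)].
  apply: (@le_trans _ _ (\int[leb]_(y in V `&` S @^-1` cube a r) (h0 + u)%:E)%E).
    apply: ge0_le_integral => //.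
    - by move=> y [Vy _]; rewrite lee_fin h_ge0.
    - move=> y [Vy Sy]; have [_ _ _] := Hr _ (le_r _ Sy).
      by rewrite SK// lee_fin ler_norml -/h0 => /andP[_ ?]; lra.
  apply: (@le_trans _ _ (\int[leb]_(y in W) (h0 + u)%:E)%E).
    apply: ge0_subset_integral => //; first exact: mLi.
    - by move=> y _; rewrite lee_fin; lra.
    - move=> y [Vy Sy] i; have [] := Hr _ (le_r _ Sy); rewrite SK// => Ly _ _ _ _.
      have := le_trans (coord_le_norm _ i) Ly; have /andP[? ?] := Sy i.
      by rewrite !mxE ler_norml => /andP[? ?]; apply/andP; split; lra.
  rewrite integral_cst; last exact: mLi.
  rewrite [X in (_ * X)%E]leb_Li; last by rewrite mulr_ge0 ?ltW//; lra.
  apply: (@le_trans _ _ (\int[leb]_(y in cube a r) (F x + e / 2)%:E)%E).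
    rewrite (integral_cst_cube _ _ (ltW r0)) -EFinM lee_fin -/D exprMn.
    by rewrite [r ^+ n * _]mulrC !mulrA ler_pM2r ?exprn_gt0// -mulrA.
  apply: ge0_le_integral => //.
  - by move=> y _; rewrite lee_fin addr_ge0// divr_ge0// ltW.
  - by apply/measurable_EFinP/measurable_funD => //; apply/measurable_EFinP; exact: mF.
  - move=> y /le_r/Hr[_ _ _ _]; rewrite lee_fin ler_norml => /andP[? _].
    by lra.
- pose W := [set w | cube (a + const_mx (u * r)) (r * (1 - 2 * u)) (Li x w)].
  apply: (@le_trans _ _ (\int[leb]_(y in cube a r) (F x + e / 2)%:E)%E).
    apply: ge0_le_integral => //; first by move=> y _; rewrite lee_fin.
    move=> y /le_r/Hr[_ _ _ _]; rewrite lee_fin ler_norml => /andP[_ ?].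
    by lra.
  pose c := Num.max (h0 - u) 0.
  apply: (@le_trans _ _ (\int[leb]_(y in W) c%:E +
      \int[leb]_(z in cube a r) e%:E)%E).
    rewrite (@integral_cst _ _ _ _ W); last exact: mLi.
    rewrite [X in (_ * X)%E]leb_Li; last by rewrite mulr_ge0 ?ltW//; lra.
    rewrite !(integral_cst_cube _ _ (ltW r0)) -EFinM -EFinD lee_fin -/D exprMn.
    rewrite [r ^+ n * _]mulrC !mulrA -mulrDl ler_pM2r ?exprn_gt0//.
    have : (h0 - u) * (D * (1 - 2 * u) ^+ n) <= c * (D * (1 - 2 * u) ^+ n).
      rewrite ler_wpM2r ?le_max ?lexx//.
      by apply: mulr_ge0; [exact: ltW|apply: exprn_ge0; lra].
    by rewrite !mulrA in pL *; lra.
  rewrite leeD2r//.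
  have WS : W `<=` V `&` S @^-1` cube a r.
    move=> w Ww.
    have Wa : cube a r (Li x w).
      move=> i; have := Ww i; rewrite !mxE => /andP[? ?].
      by apply/andP; split; lra.
    have [_ + + _ _] := Hr _ (le_r _ Wa); rewrite LiK => Vw Sw; split => // i.
    have := le_trans (coord_le_norm _ i) Sw; have := Ww i; rewrite !mxE.
    by rewrite ler_norml => /andP[? ?] /andP[? ?]; apply/andP; split; lra.
  apply: (@le_trans _ _ (\int[leb]_(y in W) (h y)%:E)%E).
    apply: ge0_le_integral => //.
    - exact: mLi.
    - by move=> y _; rewrite lee_fin le_max lexx orbT.
    - by apply: measurable_funS mhS.
    - move=> y /WS[Vy Sy]; have [_ _ _] := Hr _ (le_r _ Sy).
      rewrite SK// lee_fin ler_norml -/h0 => /andP[? _] _.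
      by rewrite ge_max h_ge0// andbT; lra.
  apply: ge0_subset_integral => //; first exact: mLi.
  by move=> y [Vy _]; rewrite lee_fin h_ge0.
Qed.


Let integral_cube_halves (f : 'rV[R]_n -> \bar R) a r :
  measurable_fun setT f -> (forall y, (0 <= f y)%E) ->
  (\int[leb]_(y in cube a r) f y =
   \sum_e \int[leb]_(y in cube (half_corner a r e) (r / 2)) f y)%E.
Proof.
move=> mf f0; have := @ge0_integral_cube_halves R n _ _ leb setT id f a r measurableT.
under eq_bigr do rewrite setTI; rewrite setTI; apply => // b s.
by rewrite setTI; exact: measurable_cube.
Qed.

(** Both sides are additive over the halves of a cube, so that the estimate
    near each point propagates to all cubes. *)
Let cube_estimate (e : R) a (r : R) : 0 < e -> 0 < r ->
  (\int[leb]_(y in V `&` S @^-1` cube a r) (h y)%:E <=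
   \int[leb]_(z in cube a r) (F z + e)%:E)%E /\
  (\int[leb]_(z in cube a r) (F z)%:E <=
   \int[leb]_(y in V `&` S @^-1` cube a r) (h y)%:E +
   \int[leb]_(z in cube a r) e%:E)%E.
Proof.
move=> e0; move: a r; apply: cube_induction => [a r r0 IH|x]; last exact: local_estimate.
have mV := open_measurable_rV oV.
have Fe0 z : (0 <= (F z + e)%:E)%E by rewrite lee_fin addr_ge0// ltW.
have F0 z : (0 <= (F z)%:E)%E by rewrite lee_fin.
have mFe : measurable_fun setT (fun z => (F z + e)%:E).
  by apply/measurable_EFinP/measurable_funD => //; apply/measurable_EFinP; exact: mF.
rewrite (@ge0_integral_cube_halves R n _ _ leb V S) //.
have me : measurable_fun setT (fun z : 'rV[R]_n => e%:E) by [].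
have e0' (z : 'rV[R]_n) : (0 <= e%:E)%E by rewrite lee_fin ltW.
rewrite (integral_cube_halves a r mFe Fe0) (integral_cube_halves a r (@mF setT) F0).
rewrite (integral_cube_halves a r me e0').
split; first by apply: lee_sum => i _; exact: (IH i).1.
by rewrite -big_split /=; apply: lee_sum => i _; exact: (IH i).2.
Qed.

Let cube_eq a (r : R) : 0 < r ->
  (\int[leb]_(y in V `&` S @^-1` cube a r) (h y)%:E = \int[leb]_(z in cube a r) (F z)%:E)%E.
Proof.
move=> r0; have rn0 : 0 < r ^+ n by rewrite exprn_gt0.
have er e : 0 < e -> 0 < e / r ^+ n by move=> ?; rewrite divr_gt0.
have eE e : (\int[leb]_(z in cube a r) (e / r ^+ n)%:E = e%:E)%E.
  by rewrite (integral_cst_cube _ _ (ltW r0)) divfK// gt_eqF.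
apply/le_anti/andP; split; apply/lee_addgt0Pr => e e0;
  have [H1 H2] := cube_estimate a (er _ e0) r0.
  apply: (le_trans H1); under eq_integral do rewrite EFinD.
  rewrite ge0_integralD ?eE//.
  - exact: measurable_cube.
  - by move=> y _; rewrite lee_fin.
  - by move=> y _; rewrite lee_fin ltW// er.
by apply: (le_trans H2); rewrite eE.
Qed.

(** The two sides agree on every cube by [cube_estimate], and an increasing
    sequence of cubes exhausts the space. *)
Theorem integral_change_of_variables :
  (\int[leb]_(y in V) (h y)%:E = \int[leb]_x (h (T x) * \det (J x))%:E)%E.
Proof.
pose Q k : set 'rV[R]_n := cube (const_mx (- k.+1%:R)) (2 * k.+1%:R).
have QP k x : Q k x <-> forall i, - k.+1%:R <= x ord0 i < k.+1%:R.
  split=> Qx i; have := Qx i; rewrite !mxE => /andP[? ?]; apply/andP; split; lra.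
have ndQ : nondecreasing_seq Q.
  move=> k l kl; apply/subsetPset => x /QP Qx; apply/QP => i.
  have /andP[? ?] := Qx i; have : k.+1%:R <= l.+1%:R :> R by rewrite ler_nat.
  by move=> ?; apply/andP; split; lra.
have UQ : \bigcup_k Q k = setT.
  apply/seteqP; split => // x _; exists (Num.truncn `|x|) => //; apply/QP => i.
  have := le_lt_trans (coord_le_norm x i) (truncnS_gt `|x|).
  by rewrite ltr_norml => /andP[? ?]; apply/andP; split; lra.
have mV := open_measurable_rV oV.
have cvF : (\int[leb]_(x in Q k) (F x)%:E @[k --> \oo] --> \int[leb]_x (F x)%:E)%E.
  rewrite -UQ; apply: ge0_nondecreasing_set_cvg_integral => //.
  - by move=> k; exact: measurable_cube.
  - by move=> k x _; rewrite lee_fin.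
have cvh : (\int[leb]_(y in V `&` S @^-1` Q k) (h y)%:E @[k --> \oo] -->
    \int[leb]_(y in V) (h y)%:E)%E.
  rewrite [X in _ --> integral _ X _](_ : V = \bigcup_k (V `&` S @^-1` Q k)); last first.
    by rewrite -setI_bigcupr -preimage_bigcup UQ preimage_setT setIT.
  apply: ge0_nondecreasing_set_cvg_integral => //.
  - move=> k l kl; apply/subsetPset => x [Vx Qx]; split => //.
    by have /subsetPset := ndQ _ _ kl; exact.
  - by move=> k; exact: mVS.
  - by move=> k; apply: measurable_funS mh => // y [].
  - by move=> k y [Vy _]; rewrite lee_fin h_ge0.
apply: (cvg_unique _ cvh) => //=.
rewrite (_ : (fun k => _) = fun k => (\int[leb]_(x in Q k) (F x)%:E)%E)//.
by apply/funext => k; apply: cube_eq; rewrite mulr_gt0.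
Qed.

End change_of_variables.

(** * Gradients and first-order expansions *)

Section gradient.
Context {R : realType} {n : nat}.
Implicit Types (f : 'rV[R]_n -> R) (x y v : 'rV[R]_n).

Lemma dotrVE x y : dotrV x y = \sum_i x ord0 i * y ord0 i.
Proof. by rewrite /dotrV mxE; apply: eq_bigr => i _; rewrite mxE. Qed.

Lemma dotrVC x y : dotrV x y = dotrV y x.
Proof. by rewrite !dotrVE; apply: eq_bigr => i _; rewrite mulrC. Qed.

Lemma dotrVDr x y z : dotrV x (y + z) = dotrV x y + dotrV x z.
Proof. by rewrite /dotrV raddfD/= mulmxDr mxE. Qed.

Lemma dotrVDl x y z : dotrV (x + y) z = dotrV x z + dotrV y z.
Proof. by rewrite dotrVC dotrVDr !(dotrVC z). Qed.

Lemma dotrVZr (a : R) x y : dotrV x (a *: y) = a * dotrV x y.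
Proof. by rewrite /dotrV linearZ/= -scalemxAr mxE. Qed.

Lemma dotrVZl (a : R) x y : dotrV (a *: x) y = a * dotrV x y.
Proof. by rewrite dotrVC dotrVZr dotrVC. Qed.

Lemma dotrVNr x y : dotrV x (- y) = - dotrV x y.
Proof. by rewrite -scaleN1r dotrVZr mulN1r. Qed.

Lemma dotrVNl x y : dotrV (- x) y = - dotrV x y.
Proof. by rewrite dotrVC dotrVNr dotrVC. Qed.

Lemma dotrVBr x y z : dotrV x (y - z) = dotrV x y - dotrV x z.
Proof. by rewrite dotrVDr dotrVNr. Qed.

Lemma dotrVBl x y z : dotrV (x - y) z = dotrV x z - dotrV y z.
Proof. by rewrite dotrVDl dotrVNl. Qed.

Lemma dotrV_delta x i : dotrV x (delta_mx ord0 i) = x ord0 i.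
Proof.
rewrite dotrVE (bigD1 i)//= big1 ?addr0 => [|j ji]; rewrite mxE ?eqxx ?mulr1//.
by rewrite (negbTE ji) andbF mulr0.
Qed.

Lemma derive_grad f x v : differentiable f x -> 'D_v f x = dotrV (grad f x) v.
Proof.
move=> df; rewrite dotrVE {1}[v]row_sum_delta deriveE// linear_sum /=.
by apply: eq_bigr => i _; rewrite linearZ/= -deriveE// mxE mulrC.
Qed.

Lemma differentiable_expansion f x : differentiable f x ->
  forall e : R, 0 < e -> exists2 d : R, 0 < d &
    forall v, `|v| < d -> `|f (x + v) - f x - dotrV (grad f x) v| <= e * `|v|.
Proof.
move=> df e e0; have /eqaddoP/(_ e e0) H := diff_locally df.
have [d /= d0 Hd] := (nbhs_normP _ _).1 H; exists d => // v vd.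
rewrite -derive_grad// deriveE//.
have := Hd v; rewrite /ball_ /= sub0r normrN => /(_ vd).
by rewrite /shift /= !fctE /= [v + x]addrC opprD addrA.
Qed.

Lemma frechet_grad f x : (forall j, differentiable (partial j f) x) ->
  frechet_at (grad f) x (hess f x).
Proof.
move=> df e e0.
have /cid2 [D D0 HD] : exists2 d : R, 0 < d & forall v, `|v| < d -> forall j,
    `|partial j f (x + v) - partial j f x - dotrV (grad (partial j f) x) v| <= e * `|v|.
  have dj j := cid2 (differentiable_expansion (df j) e0).
  exists (\big[Num.min/1]_j s2val (dj j)) => [|v vd j].
    by apply/bigmin_gtP; split => // j _; exact: (s2valP (dj j)).
  apply: (s2valP' (dj j)); apply: lt_le_trans vd _; exact: bigmin_le.
exists D => // v vD; apply: rV_norm_le => [|j]; first by rewrite mulr_ge0// ltW.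
have := HD v vD j; rewrite dotrVC dotrVE !mxE.
by congr (`|_ - _| <= _); apply: eq_bigr => i _; rewrite !mxE.
Qed.

End gradient.

(** * Derivatives of minus the logarithm of a function *)

Lemma near_eq_differentiable (R : numFieldType) (V W : normedModType R) (f g : V -> W) x :
  (\forall y \near x, f y = g y) -> differentiable f x -> differentiable g x.
Proof.
move=> fg df; have fgx0 : f x = g x := nbhs_singleton fg.
have [cdf dfE] := (diff_locallyP _ _).1 df.
have dgE : g \o shift x = cst (g x) + 'd f x +o_ 0 id.
  apply/eqaddoP => e e0; have /eqaddoP/(_ e e0) dfe := dfE.
  have fgx : \forall v \near (0 : V), f (v + x) = g (v + x).
    by move: fg; rewrite (near_shift 0 x (fun y => f y = g y)) subr0.
  by apply: filterS2 fgx dfe => v; rewrite !fctE /= fgx0 => ->.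
by apply/diff_locallyP; rewrite (diff_unique cdf dgE).
Qed.

Section log_transform.
Context {R : realType} {n : nat}.
Implicit Types (f g : 'rV[R]_n -> R) (x y v : 'rV[R]_n).

Lemma near_eq_continuous f g x :
  (\forall y \near x, f y = g y) -> {for x, continuous f} -> {for x, continuous g}.
Proof.
move=> fg cf; have fgx : f x = g x := nbhs_singleton fg.
rewrite /prop_for /continuous_at -fgx.
exact: cvg_trans (near_eq_cvg fg) cf.
Qed.

Lemma partial_near_eq i f g x :
  (\forall y \near x, f y = g y) -> partial i f x = partial i g x.
Proof. exact: near_eq_derive. Qed.

Lemma open_supp f : (forall x, supp f x -> {for x, continuous f}) -> open (supp f).
Proof.
move=> cf; rewrite openE => x fx; rewrite /interior /supp /=.
exact: (cvgr_gt _ (cf x fx) _ fx).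
Qed.

Lemma differentiable_Nln f x : 0 < f x -> differentiable f x ->
  differentiable (fun y => - ln (f y)) x.
Proof.
move=> fx df; apply: differentiableN; apply: differentiable_comp => //.
by apply/derivable1_diffP; have [] := is_derive1_ln fx.
Qed.

Lemma partial_Nln i f x : 0 < f x -> differentiable f x ->
  partial i (fun y => - ln (f y)) x = - (partial i f x / f x).
Proof.
move=> fx df; have dln : is_derive (f x) 1 (@ln R) (f x)^-1 by exact: is_derive1_ln.
have dlnf : differentiable (@ln R) (f x) by apply/derivable1_diffP; have [] := dln.
rewrite /partial deriveE; last exact: differentiable_Nln.
rewrite (@diffN _ _ _ (fun y => ln (f y))); last exact: differentiable_comp.
rewrite [in LHS]/= -[LHS]/(- _) (@diff_comp _ _ _ _ f (@ln R))//=.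
rewrite (@deriv1E _ _ (@ln R) (f x)); last by have [] := dln.
by rewrite -deriveE// derive1E derive_val.
Qed.

Lemma grad_Nln f x : 0 < f x -> differentiable f x ->
  grad (fun y => - ln (f y)) x = - (f x)^-1 *: grad f x.
Proof.
by move=> fx df; apply/rowP => i; rewrite !mxE partial_Nln// mulNr mulrC.
Qed.

Variable f : 'rV[R]_n -> R.
Hypothesis f_C2 : C2_on (supp f) f.

Let f_cont x : supp f x -> {for x, continuous f}.
Proof. by move=> /f_C2[df _ _]; exact: differentiable_continuous. Qed.

Lemma open_supp_C2 : open (supp f).
Proof. exact: open_supp. Qed.

Let near_partial j x : supp f x -> \forall y \near x,
  - (partial j f y / f y) = partial j (fun y => - ln (f y)) y.
Proof.
move=> fx; have : nbhs x (supp f) by apply: open_nbhs_nbhs; split => //; exact: open_supp.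
by apply: filterS => y fy; rewrite partial_Nln//; have [] := f_C2 fy.
Qed.

Lemma differentiable_partial_Nln j x : supp f x ->
  differentiable (partial j (fun y => - ln (f y))) x.
Proof.
move=> fx; apply: near_eq_differentiable (near_partial j fx) _.
have [df dpf _] := f_C2 fx.
apply: differentiableN; apply: differentiableM; first exact: dpf.
by apply: differentiableV => //; rewrite gt_eqF.
Qed.

Lemma hess_Nln i j x : supp f x -> hess (fun y => - ln (f y)) x i j =
  - (partial i (partial j f) x / f x - partial j f x * partial i f x / f x ^+ 2).
Proof.
move=> fx; have [df dpf _] := f_C2 fx.
have f0 : f x != 0 by rewrite gt_eqF.
rewrite mxE -(partial_near_eq i (near_partial j fx)).
have dfi : derivable f x (delta_mx ord0 i) by exact: diff_derivable.
have dpfi : derivable (partial j f) x (delta_mx ord0 i) by exact: diff_derivable.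
have dw := derivableV f0 dfi.
rewrite [LHS](deriveN (derivableM dpfi dw)).
rewrite (deriveM dpfi dw) (deriveV f0 dfi) -/(partial i f x) -/(partial i (partial j f) x).
by rewrite /GRing.scale/=; field.
Qed.

Lemma continuous_hess_Nln i j x : supp f x ->
  {for x, continuous (fun y => hess (fun z => - ln (f z)) y i j)}.
Proof.
move=> fx.
have nf : \forall y \near x, - (partial i (partial j f) y / f y -
    partial j f y * partial i f y / f y ^+ 2) = hess (fun z => - ln (f z)) y i j.
  have : nbhs x (supp f) by apply: open_nbhs_nbhs; split => //; exact: open_supp.
  by apply: filterS => y fy; rewrite hess_Nln.
apply: near_eq_continuous nf _; have [df dpf cpf] := f_C2 fx.
have f0 : f x != 0 by rewrite gt_eqF.
have cf := f_cont fx.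
have cVf : {for x, continuous (fun y => (f y)^-1)} by exact: continuousV.
apply: continuousN; apply: continuousB; first by apply: continuousM => //; exact: cpf.
apply: continuousM.
  by apply: continuousM; exact: differentiable_continuous.
by apply: continuousV; [rewrite expf_neq0|exact: continuousM].
Qed.

End log_transform.

(** * Directional derivatives and determinants *)

Section directional.
Context {R : realType} {n : nat}.
Implicit Types (f : 'rV[R]_n -> R) (x y v w : 'rV[R]_n).

Lemma dotrV_bound v w : `|dotrV v w| <= n%:R * `|v| * `|w|.
Proof.
rewrite dotrVE; apply: le_trans (ler_norm_sum _ _ _) _.
have -> : n%:R * `|v| * `|w| = \sum_(i < n) `|v| * `|w|.
  by rewrite sumr_const card_ord mulr_natl mulrnAl.
by apply: ler_sum => i _; rewrite normrM ler_pM// coord_le_norm.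
Qed.

(** Testing against [v] and [- v] turns the inequalities into equalities. *)
Lemma dotrV_le_inj x y : (forall v, dotrV x v <= dotrV y v) -> x = y.
Proof.
move=> xy; apply/rowP => i; rewrite -!dotrV_delta; apply/le_anti/andP; split => //.
by have := xy (- delta_mx ord0 i); rewrite !dotrVNr lerN2.
Qed.

Lemma dotrV_ge0 v : 0 <= dotrV v v.
Proof. by rewrite dotrVE; apply: sumr_ge0 => i _; rewrite -expr2 sqr_ge0. Qed.

Lemma dotrV_eq0 v : dotrV v v = 0 -> v = 0.
Proof.
rewrite dotrVE => /eqP; rewrite psumr_eq0 => [/allP v0|i _]; last by rewrite -expr2 sqr_ge0.
apply/rowP => i; have := v0 i (mem_index_enum _); rewrite mxE /= mulf_eq0 orbb.
by move/eqP.
Qed.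

Lemma ge_directional f x v (c d : R) : 0 < d -> differentiable f x ->
  (forall s, 0 < s < d -> s * c <= f (x + s *: v) - f x) -> c <= dotrV (grad f x) v.
Proof.
move=> d0 df fc; apply/ler_addgt0Pr => e e0.
have v1 : 0 < `|v| + 1 by rewrite ltr_wpDl.
have [r r0 H] := differentiable_expansion df (divr_gt0 e0 v1).
pose s := Num.min (d / 2) (r / 2 / (`|v| + 1)).
have s0 : 0 < s by rewrite lt_min !divr_gt0.
have sd : s < d.
  by apply: le_lt_trans (_ : d / 2 < d); [rewrite ge_min lexx|rewrite ltr_pdivrMr//; lra].
have sv : `|s *: v| = s * `|v| by rewrite normrZ gtr0_norm.
have svr : `|s *: v| < r.
  rewrite sv; apply: le_lt_trans (_ : s * (`|v| + 1) < r); first by rewrite ler_pM2l// lerDl.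
  have : s <= r / 2 / (`|v| + 1) by rewrite ge_min lexx orbT.
  by rewrite ler_pdivlMr// => /le_lt_trans; apply; rewrite ltr_pdivrMr//; lra.
have := H _ svr; rewrite sv dotrVZr ler_norml => /andP[_ H1].
have := fc s; rewrite s0 sd => /(_ isT) H2.
rewrite -(ler_pM2l s0); apply: le_trans H2 _.
have : e / (`|v| + 1) * (s * `|v|) <= s * e.
  rewrite mulrAC ler_pdivrMr// mulrCA -mulrA ler_pM2l// ler_pM2l//.
  by rewrite lerDl.
by rewrite mulrDr; lra.
Qed.

Lemma gradN f x : differentiable f x -> grad (fun y => - f y) x = - grad f x.
Proof.
by move=> df; apply/rowP => i; rewrite !mxE /partial deriveN//; exact: diff_derivable.
Qed.

Lemma le_directional f x v (c d : R) : 0 < d -> differentiable f x ->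
  (forall s, 0 < s < d -> f (x + s *: v) - f x <= s * c) -> dotrV (grad f x) v <= c.
Proof.
move=> d0 df fc; rewrite -lerN2 -dotrVNl -gradN//.
apply: (ge_directional d0); first exact: differentiableN.
by move=> s sd; rewrite mulrN -opprD lerN2; exact: fc.
Qed.

(** The chain rule for [S \o T = id], at the level of matrices. *)
Lemma frechet_left_inverse (T S : 'rV[R]_n -> 'rV[R]_n) x (J K : 'M[R]_n) :
  cancel T S -> frechet_at T x J -> frechet_at S (T x) K -> J *m K = 1%:M.
Proof.
move=> TK dT dS.
have [kJ kJ0 HJ] := mulmx_bound J; have [kK kK0 HK] := mulmx_bound K.
have key (u : 'rV[R]_n) (e : R) : 0 < e -> e <= 1 ->
    `|u - u *m J *m K| <= e * ((1 + kJ + kK) * `|u|).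
  move=> e0 e1; have [d1 d10 H1] := dT e e0; have [d2 d20 H2] := dS e e0.
  have u1 : 0 < `|u| + 1 by rewrite ltr_wpDl.
  pose h := Num.min (d1 / (`|u| + 1)) (d2 / (1 + kJ) / (`|u| + 1)).
  have kJ1 : 0 < 1 + kJ by rewrite addr_gt0.
  have h0 : 0 < h by rewrite lt_min !divr_gt0.
  have hu (a : R) : h <= a / (`|u| + 1) -> h * `|u| < a.
    by rewrite ler_pdivlMr// => /(lt_le_trans _); apply; rewrite ltr_pM2l// ltrDl.
  have normhu : `|h *: u| = h * `|u| by rewrite normrZ gtr0_norm.
  have := H1 (h *: u); rewrite normhu hu ?ge_min ?lexx// => /(_ isT) Tu.
  set w := T (x + h *: u) - T x in Tu.
  have wle : `|w| <= (1 + kJ) * (h * `|u|).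
    rewrite -[w](subrK ((h *: u) *m J)); apply: le_trans (ler_normD _ _) _.
    rewrite mulrDl lerD//; last by have := HJ (h *: u); rewrite normhu.
    by apply: le_trans Tu _; rewrite ler_wpM2r// mulr_ge0// ltW.
  have := H2 w; rewrite (le_lt_trans wle); last first.
    by rewrite mulrC -ltr_pdivlMr// hu// ge_min lexx orbT.
  have -> : S (T x + w) = x + h *: u by rewrite /w subrKC TK.
  rewrite TK [x + h *: u]addrC addrK => /(_ isT) Sw.
  rewrite -(ler_pM2l h0) -[X in X * `|_ - _|](gtr0_norm h0) -normrZ.
  rewrite scalerBr !scalemxAl.
  rewrite (_ : h *: u - (h *: u) *m J *m K =
    (h *: u - w *m K) + (w - (h *: u) *m J) *m K); last first.
    by rewrite [(w - _) *m K]mulmxBl addrA subrK.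
  apply: le_trans (ler_normD _ _) _.
  have B1 : e * `|w| <= e * ((1 + kJ) * (h * `|u|)) by rewrite ler_pM2l.
  have B2 : `|(w - (h *: u) *m J) *m K| <= kK * (e * (h * `|u|)).
    by apply: le_trans (HK _) _; rewrite ler_pM2l.
  by rewrite [leRHS](_ : _ = e * ((1 + kJ) * (h * `|u|)) + kK * (e * (h * `|u|)));
    [exact: lerD (le_trans Sw B1) B2|ring].
have zero (u : 'rV[R]_n) : u - u *m J *m K = 0.
  apply/eqP; rewrite -normr_le0; apply/ler_addgt0Pr => e e0; rewrite add0r.
  pose C := (1 + kJ + kK) * `|u| + 1.
  have C0 : 0 < C by rewrite /C ltr_wpDl// mulr_ge0// !addr_ge0// ltW.
  pose e' := Num.min 1 (e / C).
  have e'0 : 0 < e' by rewrite lt_min ltr01 divr_gt0.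
  apply: le_trans (key u e' e'0 _) _; first by rewrite ge_min lexx.
  apply: (@le_trans _ _ (e' * C)); first by rewrite ler_pM2l// /C lerDl.
  by rewrite -ler_pdivlMr// ge_min lexx orbT.
apply/row_matrixP => i; rewrite !rowE mulmx1 mulmxA.
by apply/esym/eqP; rewrite -subr_eq0 zero.
Qed.

End directional.

Section determinant.
Context {R : realType}.

Lemma continuous_det (X : topologicalType) n (A : X -> 'M[R]_n) (x : X) :
  (forall i j, {for x, continuous (fun y => A y i j)}) ->
  {for x, continuous (fun y => \det (A y))}.
Proof.
move=> cA; rewrite /determinant.
have cprod (s : seq 'I_n) (B : 'I_n -> X -> R) :
    (forall i, {for x, continuous (B i)}) ->
    {for x, continuous (fun y => \prod_(i <- s) B i y)}.
  move=> cB; elim: s => [|i s IH].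
    rewrite (_ : (fun y => _) = cst 1); first exact: cst_continuous.
    by apply/funext => y; rewrite big_nil.
  rewrite (_ : (fun y => _) = B i \* (fun y => \prod_(i <- s) B i y)); first exact: continuousM.
  by apply/funext => y; rewrite big_cons.
have csum (I : Type) (s : seq I) (B : I -> X -> R) :
    (forall i, {for x, continuous (B i)}) ->
    {for x, continuous (fun y => \sum_(i <- s) B i y)}.
  move=> cB; elim: s => [|i s IH].
    rewrite (_ : (fun y => _) = cst 0); first exact: cst_continuous.
    by apply/funext => y; rewrite big_nil.
  rewrite (_ : (fun y => _) = B i \+ (fun y => \sum_(i <- s) B i y)); first exact: continuousD.
  by apply/funext => y; rewrite big_cons.
apply: csum => s; apply: continuousM; first exact: cst_continuous.
exact: cprod.
Qed.

(** Along the segment from the identity to [M] the determinant cannot vanish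
    before the end point, so it keeps its sign. *)
Lemma det_ge0 n (M : 'M[R]_n) : (forall v : 'rV[R]_n, 0 <= dotrV (v *m M) v) ->
  0 <= \det M.
Proof.
move=> M0; rewrite leNgt; apply/negP => dM.
pose A (s : R) := (1 - s) *: 1%:M + s *: M.
have cA : continuous (fun s => \det (A s)).
  move=> s; apply: continuous_det => i j.
  rewrite (_ : (fun y => _) = (fun y => (1 - y) * (i == j)%:R + y * M i j)); last first.
    by apply/funext => y; rewrite !mxE.
  apply: continuousD; apply: continuousM; try exact: cst_continuous.
    by apply: continuousB; [exact: cst_continuous|exact: cvg_id].
  exact: cvg_id.
have [||s s01 As0] := @IVT R (fun s => \det (A s)) 0 1 0 ler01.
- exact: continuous_subspaceT.
- rewrite /A subr0 scale0r scale1r addr0 det1 subrr scale0r add0r scale1r.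
  by rewrite ge_min le_max ler01 (ltW dM) orbT.
have := s01; rewrite in_itv/= => /andP[s0 s1].
have {}s1 : s < 1.
  rewrite lt_neqAle s1 andbT; apply: contra_eqN As0 => /eqP ->.
  by rewrite /A subrr scale0r add0r scale1r lt_eqF.
have /eqP/det0P[v v0 vA] := As0.
have : 0 < dotrV (v *m A s) v.
  rewrite /A mulmxDr -!scalemxAr mulmx1 dotrVDl !dotrVZl ltr_pwDl//.
    rewrite mulr_gt0 ?subr_gt0// lt_neqAle dotrV_ge0 andbT eq_sym.
    by apply: contraNN v0 => /eqP/dotrV_eq0 ->.
  by rewrite mulr_ge0.
by rewrite vA -[0 : 'rV__](scale0r v) dotrVZl mul0r ltxx.
Qed.

End determinant.

(** * The gradient of a convex potential and of its conjugate *)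

Lemma continuous_dotrV (R : realType) n (y : 'rV[R]_n) : continuous (dotrV y).
Proof.
move=> x; apply/continuous_atP => e e0.
have k0 : 0 < n%:R * `|y| + 1 by rewrite ltr_wpDl// mulr_ge0.
exists (e / (n%:R * `|y| + 1)) => [|z]; first exact: divr_gt0.
rewrite ltr_pdivlMr// => zx; rewrite -dotrVBr; apply: le_trans (dotrV_bound _ _) _.
by apply: le_trans (ltW zx); rewrite mulrC ler_wpM2l// lerDl.
Qed.

Section legendre.
Context {R : realType} {n : nat}.
Implicit Types (x y v w : 'rV[R]_n).
Variable phi : 'rV[R]_n -> R.
Hypothesis phi_gt0 : forall x, 0 < phi x.

Let psi x := - ln (phi x).
Let psi' y := - ln (dual phi y).
Let T := grad psi.
Let S := grad psi'.
Let V := supp (dual phi).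

Hypothesis psi_convex : forall x y t, 0 < t < 1 ->
  psi (t *: x + (1 - t) *: y) <= t * psi x + (1 - t) * psi y.
Hypothesis phi_C2 : C2_on (supp phi) phi.
Hypothesis dphi_C2 : C2_on (supp (dual phi)) (dual phi).

Let phiE x : phi x = expR (- psi x).
Proof. by rewrite /psi opprK lnK// posrE. Qed.

Let dpsi x : differentiable psi x.
Proof. by have [df _ _] := phi_C2 (phi_gt0 x); exact: differentiable_Nln. Qed.

Lemma potential_gradient_ineq x y : psi x + dotrV (T x) (y - x) <= psi y.
Proof.
rewrite addrC -lerBrDr; apply: (le_directional (@ltr01 R) (dpsi x)) => s s01.
have := psi_convex y x s01.
have -> : s *: y + (1 - s) *: x = x + s *: (y - x).
  by rewrite scalerBl scale1r scalerBr addrCA addrA addrAC.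
by lra.
Qed.

Let dual_le y x : dual phi y <= expR (psi x - dotrV y x).
Proof.
apply: ge_inf; first by exists 0 => _ [z _ <-]; rewrite divr_ge0 ?expR_ge0// ltW.
by exists x => //; rewrite phiE -expRN opprK -expRD addrC.
Qed.

(** Fenchel's equality: the infimum defining the dual at [grad psi x] is
    attained at [x]. *)
Lemma dual_grad x : dual phi (T x) = expR (psi x - dotrV (T x) x).
Proof.
apply/le_anti; rewrite dual_le /=; apply: lb_le_inf.
  by exists (expR (- dotrV (T x) 0) / phi 0), 0.
move=> _ [z _ <-]; rewrite (phiE z) -expRN opprK -expRD ler_expR.
by have := potential_gradient_ineq x z; rewrite dotrVBr; lra.
Qed.

Lemma supp_dual_grad x : V (T x).
Proof. by rewrite /V /supp /= dual_grad expR_gt0. Qed.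

Let oV : open V.
Proof. exact: open_supp_C2. Qed.

Let dpsi' y : V y -> differentiable psi' y.
Proof. by move=> Vy; have [df _ _] := dphi_C2 Vy; exact: differentiable_Nln. Qed.

(** By Fenchel's inequality the affine map [y' |-> <y', x> - psi x] supports
    the dual potential at [grad psi x], so its slope [x] is the gradient there. *)
Lemma grad_dual_cancel : cancel T S.
Proof.
move=> x; apply/esym/dotrV_le_inj => v.
have /nbhs_normP[r /= r0 rV] : nbhs (T x) V.
  by apply: open_nbhs_nbhs; split => //; exact: supp_dual_grad.
have v1 : 0 < `|v| + 1 by rewrite ltr_wpDl.
apply: (ge_directional (divr_gt0 r0 v1) (dpsi' (supp_dual_grad x))) => s /andP[s0 sr].
have Vs : V (T x + s *: v).
  apply: rV; rewrite /ball_ /= opprD addrA subrr add0r normrN normrZ gtr0_norm//.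
  apply: le_lt_trans (_ : s * (`|v| + 1) < r); first by rewrite ler_pM2l// lerDl.
  by rewrite -ltr_pdivlMr.
have : ln (dual phi (T x + s *: v)) <= psi x - dotrV (T x + s *: v) x.
  by rewrite -[leRHS]expRK ler_ln ?posrE ?expR_gt0//; exact: dual_le.
rewrite /psi' dual_grad expRK dotrVDl dotrVZl [dotrV v x]dotrVC.
by move: (ln _) (psi x) => a b; lra.
Qed.

(** A potential is coercive against a slope interior to the domain of its
    conjugate, so such a slope is attained as a gradient at a minimum. *)
Lemma grad_surjective y : V y -> exists x, T x = y.
Proof.
move=> Vy; have [dy _ _] := dphi_C2 Vy.
pose c := dual phi y / 2; have c0 : 0 < c by exact: divr_gt0.
have [d d0 Hd] := (continuous_atP _ _).1 (differentiable_continuous dy) c c0.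
pose m x := psi x - dotrV y x.
have psi_slope y' x : `|y' - y| < d -> ln c <= psi x - dotrV y' x.
  move=> /Hd; rewrite ler_norml => /andP[h _].
  rewrite -[leRHS]expRK ler_ln ?posrE ?expR_gt0//; apply: le_trans (dual_le _ _).
  by move: h; rewrite /c; lra.
have coercive x i : ln c + d / 2 * `|x ord0 i| <= m x.
  (* move the slope by d / 2 along the sign of the i-th coordinate of x *)
  have delta_lt s : `|s| <= 1 -> `|y + (s * (d / 2)) *: delta_mx ord0 i - y| < d.
    move=> s1; rewrite [y + _]addrC addrK; apply: rV_norm_lt => // j.
    rewrite !mxE /= normrM normrM [`|d / 2|]gtr0_norm ?divr_gt0//.
    apply: le_lt_trans (_ : d / 2 < d); last by rewrite ltr_pdivrMr//; lra.
    have d2 : 0 <= d / 2 by rewrite divr_ge0// ltW.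
    case: (_ == _); last by rewrite normr0 mulr0.
    by rewrite normr1 mulr1 -[leRHS]mul1r ler_wpM2r.
  have [x0|x0] := leP 0 (x ord0 i).
    rewrite ger0_norm//; have := @psi_slope (y + (1 * (d / 2)) *: delta_mx ord0 i) x.
    rewrite delta_lt ?normr1// dotrVDl dotrVZl [dotrV (delta_mx _ _) _]dotrVC dotrV_delta.
    by move=> /(_ isT); rewrite /m; lra.
  rewrite ltr0_norm//; have := @psi_slope (y + (-1 * (d / 2)) *: delta_mx ord0 i) x.
  rewrite delta_lt ?normrN ?normr1// dotrVDl dotrVZl [dotrV (delta_mx _ _) _]dotrVC dotrV_delta.
  by move=> /(_ isT); rewrite /m; lra.
(* outside the cube of half side r the values of m are at least m 0 *)
pose r := `|m 0 - ln c| / (d / 2).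
have d2 : 0 < d / 2 by rewrite divr_gt0.
have r0 : 0 <= r by rewrite divr_ge0// ltW.
pose A := [set x : 'rV[R]_n | forall i, `[- r, r]%classic (x ord0 i)].
have cA : compact A.
  apply: (@rV_compact _ _ (fun=> `[- r, r]%classic)) => _; exact: segment_compact.
have A0 : A 0 by move=> i; rewrite /= in_itv /= mxE oppr_le0 r0.
have cm : {within A, continuous m}.
  apply: continuous_subspaceT => x; apply: continuousB; last exact: continuous_dotrV.
  exact: differentiable_continuous.
have [x _ xmin] := EVT_min_rV (ex_intro _ 0 A0) cA cm.
have {}xmin z : m x <= m z.
  have [/mem_set/xmin//|/existsNP[i zi]] := pselect (A z).
  apply: (@le_trans _ _ (m 0)); first by apply: xmin; rewrite inE.
  apply: le_trans (coercive z i).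
  have : r < `|z ord0 i|.
    by rewrite ltNge ler_norml; apply/negP => h; apply: zi; rewrite /= in_itv.
  rewrite /r ltr_pdivrMr// mulrC; have := ler_norm (m 0 - ln c); lra.
exists x; apply/esym/dotrV_le_inj => v; apply: (ge_directional (@ltr01 R) (dpsi x)) => s _.
by have := xmin (x + s *: v); rewrite /m dotrVDr dotrVZr; lra.
Qed.

Lemma grad_primal_cancel y : V y -> T (S y) = y.
Proof. by move=> /grad_surjective[x <-]; rewrite grad_dual_cancel. Qed.

Lemma frechet_grad_potential x : frechet_at T x (hess psi x).
Proof. by apply: frechet_grad => j; apply: differentiable_partial_Nln => //; exact: phi_gt0. Qed.

Lemma frechet_grad_dual_potential y : V y -> frechet_at S y (hess psi' y).
Proof. by move=> Vy; apply: frechet_grad => j; exact: differentiable_partial_Nln. Qed.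

Lemma hess_dual_inverse x : hess psi x *m hess psi' (T x) = 1%:M.
Proof.
apply: (frechet_left_inverse grad_dual_cancel (frechet_grad_potential x)).
exact: frechet_grad_dual_potential (supp_dual_grad x).
Qed.

Lemma hess_unit x : hess psi x \in unitmx.
Proof. exact: (mulmx1_unit (hess_dual_inverse x)).1. Qed.

Lemma hess_dualE x : hess psi' (T x) = invmx (hess psi x).
Proof. by rewrite -[LHS]mul1mx -(mulVmx (hess_unit x)) -mulmxA hess_dual_inverse mulmx1. Qed.

(** The gradient of a convex function is monotone. *)
Let hess_ge0 x v : 0 <= dotrV (v *m hess psi x) v.
Proof.
apply/ler_addgt0Pr => e e0.
pose k := n%:R * `|v| * `|v| + 1.
have k0 : 0 < k by rewrite ltr_wpDl// !mulr_ge0.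
have [d d0 H] := frechet_grad_potential x (divr_gt0 e0 k0).
have v1 : 0 < `|v| + 1 by rewrite ltr_wpDl.
pose s := d / 2 / (`|v| + 1).
have s0 : 0 < s by rewrite !divr_gt0.
have sv : `|s *: v| = s * `|v| by rewrite normrZ gtr0_norm.
have svd : `|s *: v| < d.
  rewrite sv /s mulrAC ltr_pdivrMr//.
  apply: le_lt_trans (_ : d / 2 * (`|v| + 1) < _); first by rewrite ler_pM2l ?divr_gt0// lerDl.
  by rewrite ltr_pM2r// ltr_pdivrMr//; lra.
have := H _ svd; rewrite sv; set w := _ - _ => wle.
have mono : 0 <= dotrV (T (x + s *: v) - T x) (s *: v).
  have := potential_gradient_ineq x (x + s *: v).
  have := potential_gradient_ineq (x + s *: v) x.
  have -> : x - (x + s *: v) = - (s *: v) by rewrite opprD addrA subrr add0r.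
  by rewrite [x + s *: v - x]addrC addKr dotrVNr dotrVBl; lra.
have wv : `|dotrV w v| <= e * s.
  apply: le_trans (dotrV_bound _ _) _.
  apply: (@le_trans _ _ (n%:R * (e / k * (s * `|v|)) * `|v|)).
    by rewrite ler_wpM2r// ler_wpM2l.
  rewrite (_ : _ * `|v| = e * s * (n%:R * `|v| * `|v| / k)); last by ring.
  apply: ler_piMr; first exact: mulr_ge0 (ltW e0) (ltW s0).
  by rewrite ler_pdivrMr// mul1r lerDl.
have : dotrV (T (x + s *: v) - T x) v = dotrV w v + s * dotrV (v *m hess psi x) v.
  by rewrite -dotrVZl scalemxAl -dotrVDl /w subrK.
move: mono; rewrite dotrVZr pmulr_rge0// => + Tv; rewrite Tv => h.
rewrite -(ler_pM2l s0) mulr0 mulrDr; move: wv; rewrite ler_norml => /andP[_ ?]; lra.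
Qed.

Lemma det_hess_gt0 x : 0 < \det (hess psi x).
Proof.
rewrite lt_neqAle det_ge0 ?andbT; last exact: hess_ge0.
by have := hess_unit x; rewrite unitmxE unitfE eq_sym.
Qed.

End legendre.

(** * Power means *)

Lemma powR_expR (R : realType) (a x : R) : 0 < a -> a `^ x = expR (x * ln a).
Proof. by move=> a0; rewrite /powR gt_eqF. Qed.

(** The tangent inequality [1 + u <= exp u] at [(1 - t) * s] and at [- t * s],
    averaged with weights [t] and [1 - t] and multiplied by [exp (t * s)]. *)
Lemma expR_chord_le (R : realType) (t s : R) : 0 <= t <= 1 ->
  expR (t * s) <= 1 - t + t * expR s.
Proof.
move=> /andP[t0 t1].
have e1 : 1 + (1 - t) * s <= expR ((1 - t) * s) by exact: expR_ge1Dx.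
have e2 : 1 + - t * s <= expR (- t * s) by exact: expR_ge1Dx.
have -> : 1 - t + t * expR s =
    expR (t * s) * ((1 - t) * expR (- t * s) + t * expR ((1 - t) * s)).
  rewrite mulrDr ![expR (t * s) * (_ * _)]mulrCA -!expRD.
  by rewrite mulNr addrN expR0 mulr1 mulrBl mul1r subrKC.
rewrite ler_peMr ?expR_ge0//.
have := lerD (ler_wpM2l (_ : 0 <= 1 - t) e2) (ler_wpM2l t0 e1).
rewrite subr_ge0 => /(_ t1); apply: le_trans.
by rewrite le_eqVlt; apply/orP; left; apply/eqP; ring.
Qed.

(** Beyond the end point [0] of the chord the convexity inequality is reversed. *)
Lemma expR_chord_ge (R : realType) (t s : R) : t <= 0 ->
  1 - t <= expR (t * s) - t * expR s.
Proof.
move=> t0; have e1 := expR_ge1Dx (t * s).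
have := ler_wpM2l (_ : 0 <= - t) (expR_ge1Dx s); rewrite oppr_ge0 => /(_ t0).
by lra.
Qed.

(** The exponential factor makes the second-order bound global; after
    integration it costs a slightly larger exponent. *)
Lemma expR_le_quadratic (R : realType) (t : R) :
  expR t <= 1 + t + t ^+ 2 * expR `|t|.
Proof.
have e1 := expR_ge1Dx (- t).
have e2 : expR t - 1 <= t * expR t.
  have : (1 - t) * expR t <= 1.
    rewrite -[leRHS](expRxMexpNx_1 t) mulrC ler_wpM2l ?expR_ge0//.
  by rewrite mulrBl mul1r; lra.
have [t0|t0] := leP 0 t.
  rewrite ger0_norm//; have := ler_wpM2l t0 e2.
  have [->|] := eqVneq t 0; first by rewrite expR0; lra.
  by move: (expR t) e2 => E; nra.
have e3 := expR_ge1Dx t.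
have : t ^+ 2 <= t ^+ 2 * expR `|t|.
  by rewrite ler_peMr ?sqr_ge0// -expR0 ler_expR.
suff : expR t <= 1 + t + t ^+ 2 by lra.
nra.
Qed.

Lemma integral_gt0 d (X : measurableType d) (R : realType)
    (mu : {measure set X -> \bar R}) (f : X -> R) :
  measurable_fun setT f -> (forall x, 0 < f x) -> mu setT != 0%E ->
  (0 < \int[mu]_x (f x)%:E)%E.
Proof.
move=> mf f0 mu0; rewrite lt_neqAle integral_ge0 ?andbT; last first.
  by move=> x _; rewrite lee_fin ltW.
apply: contraNN mu0 => /eqP/esym int0.
have mEf : measurable_fun setT (EFin \o f) by exact/measurable_EFinP.
have /(ae_eq_integral_abs _ measurableT mEf)[A [mA A0 sA]] : (\int[mu]_x `|(f x)%:E| = 0)%E.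
  by rewrite -[RHS]int0; apply: eq_integral => x _; rewrite gee0_abs// lee_fin ltW.
suff -> : setT = A by rewrite A0.
apply/seteqP; split => // x _; apply: sA => /= /(_ Logic.I)/eqP.
by rewrite eqe gt_eqF.
Qed.

Section power_means.
Context d (X : measurableType d) (R : realType) (mu : {measure set X -> \bar R}).
Variables w g : X -> R.
Hypotheses (mw : measurable_fun setT w) (mg : measurable_fun setT g).
Hypotheses (w_gt0 : forall x, 0 < w x) (g_gt0 : forall x, 0 < g x).
Local Open Scope ereal_scope.

Definition power_integral (l : R) : \bar R := \int[mu]_x (w x * (g x `^ l)%R)%:E.

Definition power_mean (l : R) : \bar R :=
  epow (power_integral l / \int[mu]_x (w x)%:E) l^-1.

Let mwg l : measurable_fun setT (fun x => (w x * (g x `^ l)%R)%:E).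
Proof.
apply/measurable_EFinP; apply: measurable_funM => //.
by apply: (measurableT_comp (f := fun a : R => (a `^ l)%R)) => //; exact: measurable_powR.
Qed.

Lemma power_integral0 : power_integral 0 = \int[mu]_x (w x)%:E.
Proof. by apply: eq_integral => x _; rewrite powRr0 mulr1. Qed.

Variable z : R.
Hypotheses (z_gt0 : (0 < z)%R) (zE : \int[mu]_x (w x)%:E = z%:E).

Lemma power_integral_gt0 l : 0 < power_integral l.
Proof.
apply: integral_gt0.
- by apply/measurable_EFinP; exact: mwg.
- by move=> x; rewrite mulr_gt0// powR_gt0.
apply/eqP => mu0; have : \int[mu]_x (w x)%:E = 0.
  by apply: null_set_integral => //; exact/measurable_EFinP.
by rewrite zE => /eqP; rewrite eqe gt_eqF.
Qed.

(** With [c] the mean value of [g ^ m], the normalization [s = ln (g x ^ m / c)]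
    makes the mean value of [exp s] equal to [1], so that the chord inequalities
    integrate to inequalities between power means. *)
Let chordE x (m c l : R) : (0 < c)%R -> (m != 0)%R ->
  let t := (l / m)%R in let s := (m * ln (g x) - ln c)%R in
  (g x `^ l = c `^ t * expR (t * s) /\ g x `^ m = c * expR s)%R.
Proof.
move=> c0 m0 t s; rewrite !powR_expR// -expRD; split.
  by congr expR; rewrite /s /t; field.
by rewrite -{1}(lnK c0) -expRD; congr expR; rewrite /s; ring.
Qed.

Lemma power_integral_le l m c : (0 <= l <= m)%R -> (0 < m)%R -> (0 < c)%R ->
  power_integral m = (c * z)%:E -> power_integral l <= (c `^ (l / m) * z)%:E.
Proof.
move=> /andP[l0 lm] m0 c0 Nm; set t := (l / m)%R.
have t01 : (0 <= t <= 1)%R by rewrite divr_ge0 ?(ltW m0)//= ler_pdivrMr// mul1r.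
have /andP[t0 t1] := t01.
have k1 : (0 <= c `^ t * (1 - t))%R by rewrite mulr_ge0 ?powR_ge0// subr_ge0.
have k2 : (0 <= c `^ t * t / c)%R.
  by rewrite mulr_ge0 ?invr_ge0 ?(ltW c0)// mulr_ge0// powR_ge0.
apply: (@le_trans _ _ (\int[mu]_x ((c `^ t * (1 - t))%:E * (w x)%:E +
    (c `^ t * t / c)%:E * (w x * g x `^ m)%:E))).
  apply: ge0_le_integral => //.
  - by move=> x _; rewrite lee_fin mulr_ge0 ?powR_ge0// ltW.
  - by apply: emeasurable_funD; apply: measurable_funeM => //; exact/measurable_EFinP.
  - move=> x _; have [-> ->] := @chordE x m c l c0 (lt0r_neq0 m0).
    rewrite -!EFinM -EFinD lee_fin -/t; set s := (m * ln (g x) - ln c)%R.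
    have := expR_chord_le s t01 => /(ler_wpM2l (powR_ge0 c t)).
    move=> /(ler_wpM2l (ltW (w_gt0 x)))/le_trans; apply.
    by rewrite le_eqVlt; apply/orP; left; apply/eqP; field; rewrite gt_eqF.
rewrite ge0_integralD//.
- rewrite !ge0_integralZl//.
  + rewrite zE -/(power_integral m) Nm -!EFinM -EFinD lee_fin.
    by rewrite le_eqVlt; apply/orP; left; apply/eqP; field; rewrite gt_eqF.
  + by move=> x _; rewrite lee_fin mulr_ge0 ?powR_ge0// ltW.
  + exact/measurable_EFinP.
  + by move=> x _; rewrite lee_fin ltW.
- by move=> x _; rewrite -EFinM lee_fin mulr_ge0// ltW.
- by apply: measurable_funeM; exact/measurable_EFinP.
- by move=> x _; rewrite -EFinM lee_fin mulr_ge0// mulr_ge0 ?powR_ge0// ltW.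
- exact: measurable_funeM.
Qed.

Lemma power_integral_ge l m c : (l <= 0)%R -> (0 < m)%R -> (0 < c)%R ->
  power_integral m = (c * z)%:E -> (c `^ (l / m) * z)%:E <= power_integral l.
Proof.
move=> l0 m0 c0 Nm; set t := (l / m)%R.
have t0 : (t <= 0)%R by rewrite ler_pdivrMr// mul0r.
have k1 : (0 <= c `^ t * (1 - t))%R by rewrite mulr_ge0 ?powR_ge0// subr_ge0 (le_trans t0).
have k2 : (0 <= c `^ t * (- t) / c)%R.
  by rewrite mulr_ge0 ?invr_ge0 ?(ltW c0)// mulr_ge0 ?oppr_ge0// powR_ge0.
have wg0 x r : (0 <= w x * g x `^ r)%R by rewrite mulr_ge0 ?powR_ge0// ltW.
have H : \int[mu]_x ((c `^ t * (1 - t))%:E * (w x)%:E) <=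
    \int[mu]_x ((w x * g x `^ l)%:E + (c `^ t * (- t) / c)%:E * (w x * g x `^ m)%:E).
  apply: ge0_le_integral => //.
  - by move=> x _; rewrite -EFinM lee_fin mulr_ge0// ltW.
  - by apply: measurable_funeM; exact/measurable_EFinP.
  - by apply: emeasurable_funD => //; exact: measurable_funeM.
  - move=> x _; have [-> ->] := @chordE x m c l c0 (lt0r_neq0 m0).
    rewrite -!EFinM -EFinD lee_fin -/t; set s := (m * ln (g x) - ln c)%R.
    have := expR_chord_ge s t0 => /(ler_wpM2l (powR_ge0 c t)).
    move=> /(ler_wpM2l (ltW (w_gt0 x))) => h.
    rewrite [leLHS](_ : _ = w x * (c `^ t * (1 - t)))%R; last by ring.
    apply: (le_trans h).
    by rewrite le_eqVlt; apply/orP; left; apply/eqP; field; rewrite gt_eqF.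
move: H; rewrite ge0_integralD//; last 2 first.
- by move=> x _; rewrite -EFinM lee_fin mulr_ge0.
- exact: measurable_funeM.
rewrite !ge0_integralZl//; last 2 first.
- exact/measurable_EFinP.
- by move=> x _; rewrite lee_fin ltW.
- rewrite zE -/(power_integral m) -/(power_integral l) Nm -!EFinM.
  rewrite addeC -leeBlDl// -EFinB; apply: le_trans; rewrite lee_fin.
  by rewrite le_eqVlt; apply/orP; left; apply/eqP; field; rewrite gt_eqF.
- by move=> x _; rewrite lee_fin.
- by move=> x _; rewrite lee_fin.
Qed.

Lemma power_integral_cases l : power_integral l = +oo \/
  exists2 c, (0 < c)%R & power_integral l = (c * z)%:E.
Proof.
have := power_integral_gt0 l; case: (power_integral l) => [r| |]//; last by left.
rewrite lte_fin => r0; right; exists (r / z)%R; first exact: divr_gt0.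
by rewrite divfK// gt_eqF.
Qed.

Lemma power_mean_fin l c : (0 < c)%R -> power_integral l = (c * z)%:E ->
  power_mean l = (expR (ln c / l))%:E.
Proof.
move=> c0 Nl; rewrite /power_mean Nl zE inver gt_eqF// -EFinM mulfK ?gt_eqF//.
have -> : epow c%:E l^-1 = (c `^ l^-1)%:E.
  rewrite /epow; case: ifP => // _; rewrite poweR_EFin powRN inver invr_eq0 gt_eqF ?powR_gt0//.
  by rewrite invrK.
by rewrite powR_expR// mulrC.
Qed.

Lemma power_mean_pinfty l : (0 < l)%R -> power_integral l = +oo -> power_mean l = +oo.
Proof.
move=> l0 Nl; rewrite /power_mean Nl zE inver gt_eqF// gt0_mulye ?lte_fin ?invr_gt0//.
by rewrite /epow ltNge invr_ge0 (ltW l0)/= gt_eqF// invr_gt0.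
Qed.

Lemma power_mean_pinfty_neg l : (l < 0)%R -> power_integral l = +oo -> power_mean l = 0.
Proof.
move=> l0 Nl; rewrite /power_mean Nl zE inver gt_eqF// gt0_mulye ?lte_fin ?invr_gt0//.
by rewrite /epow invr_lt0 l0 poweRyr ?invey// oppr_eq0 invr_eq0 lt_eqF.
Qed.

Lemma power_mean_gt0 l : (0 < l)%R -> 0 < power_mean l.
Proof.
move=> l0; have [|[c c0 Nl]] := power_integral_cases l.
  by move/power_mean_pinfty => ->.
by rewrite (power_mean_fin c0 Nl) lte_fin expR_gt0.
Qed.

Lemma power_mean_nondecreasing l m : (0 < l <= m)%R -> power_mean l <= power_mean m.
Proof.
move=> /andP[l0 lm]; have m0 := lt_le_trans l0 lm.
have [Nm|[c c0 Nm]] := power_integral_cases m; first by rewrite (power_mean_pinfty m0 Nm) leey.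
have lm0 : (0 <= l <= m)%R by rewrite (ltW l0).
have := power_integral_le lm0 m0 c0 Nm.
have [->//|[b b0 Nl]] := power_integral_cases l.
rewrite Nl lee_fin ler_pM2r// (power_mean_fin c0 Nm) (power_mean_fin b0 Nl) lee_fin ler_expR.
move=> h; have : (ln b <= l / m * ln c)%R by rewrite -ln_powR ler_ln ?posrE ?powR_gt0.
by rewrite ler_pdivrMr// (_ : ln c / m * l = l / m * ln c)%R//; ring.
Qed.

(** The chord inequality with an exponent [l / m < 0] bounds the integral from
    below, and the outer power [1 / l < 0] reverses this. *)
Lemma power_mean_neg_le l m : (l < 0)%R -> (0 < m)%R -> power_mean l <= power_mean m.
Proof.
move=> l0 m0.
have [Nm|[c c0 Nm]] := power_integral_cases m; first by rewrite (power_mean_pinfty m0 Nm) leey.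
have [Nl|[b b0 Nl]] := power_integral_cases l.
  by rewrite (power_mean_pinfty_neg l0 Nl) ltW// power_mean_gt0.
have := power_integral_ge (ltW l0) m0 c0 Nm.
rewrite Nl lee_fin ler_pM2r// (power_mean_fin c0 Nm) (power_mean_fin b0 Nl) lee_fin ler_expR.
move=> h; have : (l / m * ln c <= ln b)%R by rewrite -ln_powR ler_ln ?posrE ?powR_gt0.
by rewrite ler_ndivrMr// (_ : ln c / m * l = l / m * ln c)%R//; ring.
Qed.


Definition power_mean0 : \bar R := lim (power_mean l @[l --> (0 : R)^'+]).

Lemma cvg_power_mean0 : power_mean l @[l --> (0 : R)^'+] --> power_mean0.
Proof.
apply/cvg_ex; exists (ereal_inf (power_mean @` [set` `]0%R, +oo[%R])).
apply: nondecreasing_at_right_cvge => // l m; rewrite !in_itv/= !andbT => l0 m0 lm.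
by apply: power_mean_nondecreasing; rewrite l0.
Qed.

Lemma power_mean0_le l : (0 < l)%R -> power_mean0 <= power_mean l.
Proof.
move=> l0; apply: (cvge_to_le cvg_power_mean0).
near=> m; apply: power_mean_nondecreasing; apply/andP; split => //.
by near: m; exact: nbhs_right_le.
Unshelve. all: by end_near. Qed.

Lemma power_mean0_ge0 : 0 <= power_mean0.
Proof.
apply: (cvge_to_ge cvg_power_mean0).
by near=> l; apply: ltW; apply: power_mean_gt0.
Unshelve. all: by end_near. Qed.

Lemma power_mean_le0 l : (l < 0)%R -> power_mean l <= power_mean0.
Proof.
move=> l0; apply: (cvge_to_ge cvg_power_mean0).
by near=> m; exact: power_mean_neg_le.
Unshelve. all: by end_near. Qed.


(** The second-order expansion of [exp (t * ln g)] in [t], integrated. *)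
Let power_integral_expansion (l0 : R) : (0 < l0)%R ->
  power_integral l0 < +oo -> power_integral (- l0) < +oo ->
  exists k1 k2 : R, forall t, (`|t| <= l0 / 2)%R ->
    power_integral t <= ((1 + t * k1 + t ^+ 2 * k2) * z)%:E.
Proof.
move=> l00 Np Nn.
pose u x := ln (g x).
pose B x := (w x * g x `^ l0 + w x * g x `^ (- l0))%R.
have mu_ : measurable_fun setT u by exact: measurableT_comp (@measurable_ln R) mg.
have iwg l : power_integral l < +oo -> mu.-integrable setT (fun x => (w x * g x `^ l)%:E).
  move=> Nl; apply/integrableP; split => //.
  under eq_integral do rewrite gee0_abs ?lee_fin ?mulr_ge0 ?powR_ge0 ?ltW//.
  by [].
have iB : mu.-integrable setT (EFin \o B).
  exact: (integrableD measurableT (iwg _ Np) (iwg _ Nn)).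
have iw : mu.-integrable setT (EFin \o w).
  apply/integrableP; split; first exact/measurable_EFinP.
  rewrite (eq_integral (EFin \o w)); last by move=> x _; rewrite /= ger0_norm ?ltW.
  by rewrite zE ltry.
have expB x : (expR (l0 * `|u x|) <= g x `^ l0 + g x `^ (- l0))%R.
  rewrite !powR_expR// -/(u x); have [u0|u0] := leP 0%R (u x).
    by rewrite ger0_norm// lerDl expR_ge0.
  by rewrite ltr0_norm// mulrN mulNr lerDr expR_ge0.
have iwu : mu.-integrable setT (EFin \o (w \* u)%R).
  apply: (le_integrable _ _ _ (integrableZl measurableT l0^-1 iB)) => //.
    by apply/measurable_EFinP; exact: measurable_funM.
  move=> x _; rewrite /= lee_fin !normrM (gtr0_norm (w_gt0 x)).
  rewrite [(`|l0^-1|)%R]gtr0_norm ?invr_gt0// ler_pdivlMl// mulrCA.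
  apply: le_trans (ler_norm _); rewrite /B -mulrDr ler_pM2l//.
  apply: le_trans (expB x); apply: le_trans (expR_ge1Dx _).
  by rewrite lerDr.
pose k1 := fine (\int[mu]_x (w x * u x)%:E); pose k2 := fine (\int[mu]_x (B x)%:E).
exists (k1 / z)%R, (16 / l0 ^+ 2 * k2 / z)%R => t tl.
apply: (@le_trans _ _ (\int[mu]_x ((w x)%:E + (t%:E * (w x * u x)%:E +
    (t ^+ 2 * (16 / l0 ^+ 2))%:E * (B x)%:E)))).
  apply: ge0_le_integral => //.
  - by move=> x _; rewrite lee_fin mulr_ge0 ?powR_ge0// ltW.
  - apply: emeasurable_funD; first exact/measurable_EFinP.
    apply: emeasurable_funD; apply: measurable_funeM.
      by apply/measurable_EFinP; exact: measurable_funM.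
    exact: (measurable_int mu).
  move=> x _; rewrite -!EFinM -!EFinD lee_fin powR_expR// -/(u x).
  have := expR_le_quadratic (t * u x) => /(ler_wpM2l (ltW (w_gt0 x)))/le_trans; apply.
  rewrite !mulrDr mulr1 -addrA lerD2l mulrCA lerD2l.
  rewrite [leLHS](_ : _ = w x * (t ^+ 2 * (u x ^+ 2 * expR `|t * u x|)))%R; last by ring.
  rewrite [leRHS](_ : _ = w x * (t ^+ 2 *
    (16 / l0 ^+ 2 * (g x `^ l0 + g x `^ (- l0)))))%R; last by ring.
  rewrite ler_pM2l// ler_wpM2l ?sqr_ge0//.
  set v := (l0 * `|u x| / 2)%R.
  have v0 : (0 <= v)%R by rewrite /v !mulr_ge0 ?invr_ge0// ltW.
  have v2 : (v ^+ 2 <= 4 * expR v)%R.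
    have := expR_ge1Dx (v / 2); have -> : expR v = (expR (v / 2) ^+ 2)%R.
      by rewrite expr2 -expRD -splitr.
    by move: (expR _) => E; nra.
  have u2 : (u x ^+ 2 = 4 / l0 ^+ 2 * v ^+ 2)%R.
    by rewrite /v -[in LHS]real_normK ?num_real//; field; rewrite gt_eqF.
  have tv : (expR `|t * u x| <= expR v)%R.
    by rewrite ler_expR normrM /v mulrAC ler_wpM2r.
  apply: (@le_trans _ _ (16 / l0 ^+ 2 * (expR v * expR v))%R).
    rewrite u2 (_ : 16 / l0 ^+ 2 = 4 / l0 ^+ 2 * 4)%R; last by field; rewrite gt_eqF.
    have : (v ^+ 2 * expR `|t * u x| <= 4 * expR v * expR v)%R.
      by apply: ler_pM => //; rewrite ?sqr_ge0 ?expR_ge0.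
    have k0 : (0 <= 4 / l0 ^+ 2)%R by rewrite divr_ge0 ?sqr_ge0.
    by move=> /(ler_wpM2l k0); rewrite !mulrA.
  rewrite ler_wpM2l ?divr_ge0 ?sqr_ge0// -expRD; apply: le_trans (expB x).
  by rewrite ler_expR /v -splitr.
have iZ1 := integrableZl measurableT t iwu.
have iZ2 := integrableZl measurableT (t ^+ 2 * (16 / l0 ^+ 2))%R iB.
rewrite integralD//; last exact: integrableD.
rewrite integralD// zE !integralZl//.
rewrite -(fineK (integrable_fin_num measurableT iwu)) -(fineK (integrable_fin_num measurableT iB)).
rewrite -/k1 -/k2 -!EFinM -!EFinD lee_fin.
by rewrite le_eqVlt; apply/orP; left; apply/eqP; field; rewrite !gt_eqF.
Qed.


(** When the integrals are finite near [0], the second-order expansion bounds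
    the logarithm of [power_mean l] by [k1 + O(l)] from above for [l > 0] and by
    [k1 - O(|l|)] from below for [l < 0]. As [power_mean0] lies between the means
    of negative and of positive exponent, all of them tend to [exp k1]. *)
Lemma cvg_power_mean_dnbhs :
  (\forall l \near (0%R : R)^', power_integral l < +oo) ->
  power_mean l @[l --> (0%R : R)^'] --> power_mean0.
Proof.
move=> /nbhs_ballP[e /= e0 Nfin].
have {}Nfin l : l != 0%R -> (`|l| < e)%R -> power_integral l < +oo.
  by move=> l0 le; apply: Nfin => //; rewrite /ball /= sub0r normrN.
pose l0 := (e / 2)%R; have l00 : (0 < l0)%R by rewrite divr_gt0.
have l0e : (`|l0| < e)%R by rewrite gtr0_norm// /l0; lra.
have [||k1 [k2 H]] := power_integral_expansion l00.
- by apply: Nfin => //; rewrite gt_eqF.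
- by apply: Nfin; rewrite ?normrN// oppr_eq0 gt_eqF.
have lnle t : t != 0%R -> (`|t| <= l0 / 2)%R -> exists2 c,
    power_mean t = (expR (c / t))%:E & (c <= t * k1 + t ^+ 2 * k2)%R.
  move=> t0 tl; have [Nt|[c c0 Nt]] := power_integral_cases t.
    by have := H t tl; rewrite Nt.
  exists (ln c); first exact: power_mean_fin.
  have := H t tl; rewrite Nt lee_fin ler_pM2r// => /le_trans cle.
  rewrite -ler_expR (lnK c0); apply: cle.
  by apply: le_trans (expR_ge1Dx _); rewrite addrA.
have upper t : (0 < t)%R -> (t <= l0 / 2)%R ->
    power_mean t <= (expR (k1 + t * k2))%:E.
  move=> t0 tl; have [||c -> cle] := lnle t; rewrite ?gt_eqF ?gtr0_norm//.
  rewrite lee_fin ler_expR ler_pdivrMr//; apply: le_trans cle _.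
  by rewrite le_eqVlt; apply/orP; left; apply/eqP; ring.
have lower t : (0 < t)%R -> (t <= l0 / 2)%R ->
    (expR (k1 - t * k2))%:E <= power_mean (- t).
  move=> t0 tl; have [||c -> cle] := lnle (- t)%R; rewrite ?oppr_eq0 ?gt_eqF ?normrN ?gtr0_norm//.
  rewrite lee_fin ler_expR ler_ndivlMr ?oppr_lt0//; apply: le_trans cle _.
  by rewrite le_eqVlt; apply/orP; left; apply/eqP; ring.
pose f (s t : R) := (expR (k1 + s * (`|t| * k2)))%:E.
have sandwich : \forall t \near (0%R : R)^', f (-1)%R t <= power_mean t <= f 1%R t.
  near=> t; have t0 : t != 0%R by near: t; exact: nbhs_dnbhs_neq.
  have tl : (`|t| <= l0 / 2)%R by near: t; apply: dnbhs0_le; rewrite divr_gt0.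
  have nt0 : (0 < `|t|)%R by rewrite normr_gt0.
  rewrite /f mul1r mulN1r; have U := upper _ nt0 tl; have L := lower _ nt0 tl.
  have L0 : power_mean (- `|t|) <= power_mean0 by apply: power_mean_le0; rewrite oppr_lt0.
  have U0 := power_mean0_le nt0.
  have [t_gt0|t_lt0|] := ltrgtP t 0%R; last by move=> t00; rewrite t00 eqxx in t0.
    move: U L L0 U0; rewrite ltr0_norm// opprK => U -> L0 U0.
    exact: le_trans L0 (le_trans U0 U).
  move: U L L0 U0; rewrite gtr0_norm// => -> L L0 U0; rewrite andbT.
  exact: le_trans L (le_trans L0 U0).
have cvf s : f s t @[t --> (0%R : R)^'] --> (expR k1)%:E.
  have -> : expR k1 = expR (k1 + s * (`|(0 : R)%R| * k2))%R by rewrite normr0 mul0r mulr0 addr0.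
  apply: cvg_EFin; first exact: nearW.
  pose q (t : R) := expR (k1 + s * (`|t| * k2))%R.
  have cq : {for 0%R, continuous q}.
    apply: (@continuous_comp _ _ _ (fun t : R => k1 + s * (`|t| * k2))%R expR);
      last exact: continuous_expR.
    apply: continuousD; first exact: cst_continuous.
    apply: continuousM; first exact: cst_continuous.
    apply: continuousM; last exact: cst_continuous.
    exact: norm_continuous.
  exact: cvg_within_filter cq.
have cvM : power_mean l @[l --> (0%R : R)^'] --> (expR k1)%:E.
  by apply: (squeeze_cvge sandwich); exact: cvf.
rewrite (_ : power_mean0 = (expR k1)%:E); first exact: cvM.
apply: cvg_lim => //; exact: cvg_dnbhs_at_right cvM.
Unshelve. all: by end_near. Qed.

Lemma power_mean_cst k l : (0 < k)%R -> (forall x, g x = k) -> l != 0%R ->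
  power_mean l = k%:E.
Proof.
move=> k0 gk l0; rewrite (@power_mean_fin l (k `^ l)%R); last 2 first.
- by rewrite powR_gt0.
- rewrite /power_integral; under eq_integral do rewrite gk mulrC EFinM.
  rewrite ge0_integralZl ?lee_fin ?powR_ge0//; first by rewrite zE.
  + exact/measurable_EFinP.
  + by move=> x _; rewrite lee_fin ltW.
by rewrite ln_powR mulrAC divff// mul1r lnK.
Qed.

Lemma power_mean0_cst k : (0 < k)%R -> (forall x, g x = k) -> power_mean0 = k%:E.
Proof.
move=> k0 gk; apply/le_anti.
rewrite -{1}(power_mean_cst k0 gk (oner_neq0 R)) power_mean0_le//=.
by rewrite -(@power_mean_cst k (-1)%R k0 gk) ?power_mean_le0// ?oppr_lt0// oppr_eq0 oner_eq0.
Qed.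

End power_means.

(** * Affine surface areas of a function and of its dual *)

Lemma cvg_onem_dnbhs0 (R : realType) : 1 - a @[a --> (1 : R)^'] --> (0 : R)^'.
Proof.
move=> A /nbhs_ballP[e /= e0 eA]; apply/nbhs_ballP; exists e => //= a.
rewrite /ball /= => a1 an1; apply: eA; last by rewrite subr_eq0 eq_sym.
by rewrite /ball /= sub0r normrN.
Qed.

Lemma near_onem_dnbhs (R : realType) (P Q : R -> Prop) :
  (forall l, P (1 - l) -> Q l) ->
  (\forall a \near (1 : R)^', P a) -> \forall l \near (0 : R)^', Q l.
Proof.
move=> PQ /nbhs_ballP[e /= e0 eP]; apply/nbhs_ballP; exists e => //= l.
rewrite /ball /= => l1 ln0; apply/PQ/eP.
  by rewrite /ball /= opprB subrKC -normrN -sub0r.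
by rewrite -subr_eq0 addrAC subrr add0r oppr_eq0.
Qed.

Section duality.
Context {R : realType} {n : nat}.
Local Notation leb := (lebesgue_rV R n).
Implicit Types (x y v : 'rV[R]_n).
Variable phi : 'rV[R]_n -> R.
Hypothesis phi_gt0 : forall x, 0 < phi x.
Let psi x := - ln (phi x).
Let psi' y := - ln (dual phi y).
Let T := grad psi.
Let S := grad psi'.
Let V := supp (dual phi).
Hypothesis psi_convex : forall x y t, 0 < t < 1 ->
  psi (t *: x + (1 - t) *: y) <= t * psi x + (1 - t) * psi y.
Hypothesis phi_C2 : C2_on (supp phi) phi.
Hypothesis dphi_C2 : C2_on (supp (dual phi)) (dual phi).

Let supp_phi x : supp phi x. Proof. exact: phi_gt0. Qed.

Let TK : cancel T S := grad_dual_cancel phi_gt0 psi_convex phi_C2 dphi_C2.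
Let VT x : V (T x) := supp_dual_grad phi_gt0 psi_convex phi_C2 x.
Let SK y : V y -> T (S y) = y :=
  @grad_primal_cancel _ _ _ phi_gt0 psi_convex phi_C2 dphi_C2 y.
Let dualE x : dual phi (T x) = expR (psi x - dotrV (T x) x) :=
  dual_grad phi_gt0 psi_convex phi_C2 x.
Let hessE x : hess psi' (T x) = invmx (hess psi x) :=
  hess_dualE phi_gt0 psi_convex phi_C2 dphi_C2 x.
Let det_gt0 x : 0 < \det (hess psi x) :=
  det_hess_gt0 phi_gt0 psi_convex phi_C2 dphi_C2 x.

(** The base of the power in [affine_surface_area]. *)
Definition asa_density (f : 'rV[R]_n -> R) y : R :=
  expR (dotrV (grad f y) y / f y) / f y ^+ 2 * \det (hess (fun z => - ln (f z)) y).

Let grad_over (f : 'rV[R]_n -> R) y : 0 < f y -> differentiable f y ->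
  dotrV (grad f y) y / f y = - dotrV (grad (fun z => - ln (f z)) y) y.
Proof. by move=> fy df; rewrite grad_Nln// dotrVZl mulNr opprK mulrC. Qed.

Lemma asa_densityE x :
  asa_density phi x = expR (2 * psi x - dotrV (T x) x) * \det (hess psi x).
Proof.
have [df _ _] := phi_C2 (supp_phi x).
rewrite /asa_density grad_over//; congr (_ * _).
rewrite -[X in _ / X ^+ 2](lnK (phi_gt0 x)) -expRM_natl -expRN -expRD; congr expR.
by rewrite /psi /T; ring.
Qed.

Lemma asa_density_gt0 x : 0 < asa_density phi x.
Proof. by rewrite asa_densityE mulr_gt0 ?expR_gt0. Qed.

(** The Hessians at [x] and at [T x] are mutually inverse, and Fenchel's equality
    makes the exponential factors inverse to each other as well. *)
Lemma asa_density_dual x : asa_density (dual phi) (T x) = (asa_density phi x)^-1.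
Proof.
have [df _ _] := dphi_C2 (VT x).
rewrite asa_densityE /asa_density grad_over//; last exact: VT.
rewrite -/psi' -/S TK dualE hessE det_inv [RHS]invfM -expRM_natl -!expRN -expRD.
by congr (expR _ * _); rewrite [dotrV x _]dotrVC; ring.
Qed.

Let continuous_density (f : 'rV[R]_n -> R) y : C2_on (supp f) f -> supp f y ->
  {for y, continuous (asa_density f)}.
Proof.
move=> fC2 fy; have [df dpf _] := fC2 y fy.
have f0 : f y != 0 by rewrite gt_eqF.
have cf : {for y, continuous f} by exact: differentiable_continuous.
apply: continuousM; last first.
  by apply: continuous_det => i j; exact: continuous_hess_Nln.
apply: continuousM; last first.
  by apply: continuousV; [rewrite expf_neq0|exact: continuousM].
apply: (continuous_comp (f := fun y => dotrV (grad f y) y / f y)); last exact: continuous_expR.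
apply: continuousM; last exact: continuousV.
have -> : (fun y => dotrV (grad f y) y) = \sum_i (fun y => partial i f y * y ord0 i).
  by apply/funext => z; rewrite fct_sumE dotrVE; apply: eq_bigr => i _; rewrite mxE.
elim/big_ind : _ => [|a b ca cb|i _]; first exact: cst_continuous.
  exact: continuousD.
apply: continuousM; first exact: differentiable_continuous.
exact: coord_continuous.
Qed.


Let cphi x : {for x, continuous phi}.
Proof. by have [df _ _] := phi_C2 (supp_phi x); exact: differentiable_continuous. Qed.

Lemma measurable_primal : measurable_fun setT phi.
Proof. by apply: continuous_measurable_rV => [|x _]; [exact: openT|exact: cphi]. Qed.

Lemma measurable_asa_density : measurable_fun setT (asa_density phi).
Proof.
apply: continuous_measurable_rV => [|x _]; first exact: openT.
exact: continuous_density.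
Qed.

Lemma affine_surface_areaE l :
  affine_surface_area l phi = power_integral leb phi (asa_density phi) l.
Proof.
rewrite /affine_surface_area (_ : supp phi = setT) //.
by apply/seteqP; split => // x _; exact: phi_gt0.
Qed.

Let oV : open V. Proof. exact: open_supp_C2. Qed.

Let dual_density_gt0 y : V y -> 0 < asa_density (dual phi) y.
Proof. by move=> Vy; rewrite -(SK Vy) asa_density_dual invr_gt0 asa_density_gt0. Qed.

(** The substitution [y = grad psi x] exchanges the affine surface areas of
    the function and of its dual, the parameter [l] becoming [1 - l]. *)
Theorem affine_surface_area_dual l :
  affine_surface_area l (dual phi) = power_integral leb phi (asa_density phi) (1 - l).
Proof.
pose h y := dual phi y * asa_density (dual phi) y `^ l.
have ch y : V y -> {for y, continuous h}.
  move=> Vy; have [df _ _] := dphi_C2 Vy.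
  apply: (@near_eq_continuous R n
      (fun y => dual phi y * expR (l * ln (asa_density (dual phi) y)))).
    have : nbhs y V by exact: open_nbhs_nbhs.
    by apply: filterS => z Vz; rewrite /h powR_expR// dual_density_gt0.
  apply: continuousM; first exact: differentiable_continuous.
  apply: (continuous_comp (f := fun y => l * ln (asa_density (dual phi) y)));
    last exact: continuous_expR.
  apply: continuousM; first exact: cst_continuous.
  apply: (continuous_comp (f := asa_density (dual phi)) (g := @ln R));
    first exact: continuous_density.
  exact: continuous_ln (dual_density_gt0 Vy).
rewrite -[LHS]/(\int[leb]_(y in V) (h y)%:E)%E.
rewrite (@integral_change_of_variables R n T S V (hess psi) h) //.
- apply: eq_integral => x _; congr EFin.
  have gx := asa_density_gt0 x; rewrite /h asa_density_dual dualE.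
  have key : phi x * asa_density phi x =
      expR (psi x - dotrV (T x) x) * \det (hess psi x).
    rewrite asa_densityE mulrA -{1}(lnK (phi_gt0 x)) -expRD.
    by congr (expR _ * _); rewrite /psi; ring.
  rewrite powR_expR ?invr_gt0// lnV// powR_expR// mulrBl mul1r [in RHS]expRD lnK//.
  by rewrite mulrA key mulrN mulrAC.
- exact: (frechet_grad_potential phi_gt0 phi_C2).
- by move=> x; rewrite -hessE; apply: (frechet_grad_dual_potential dphi_C2); exact: VT.
- move=> y Vy; apply: frechet_continuous.
  exact: (frechet_grad_dual_potential dphi_C2 Vy).
- by move=> x; apply: continuous_det => i j; exact: continuous_hess_Nln.
- by move=> y Vy; rewrite /h mulr_ge0 ?powR_ge0// ltW.
Qed.

End duality.

(** * The limit of the power means *)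

Section omega.
Context {R : realType} {n : nat}.
Local Notation leb := (lebesgue_rV R n).
Implicit Types (x y v : 'rV[R]_n).
Variable phi : 'rV[R]_n -> R.
Hypothesis phi_gt0 : forall x, 0 < phi x.
Let psi x := - ln (phi x).
Hypothesis psi_convex : forall x y t, 0 < t < 1 ->
  psi (t *: x + (1 - t) *: y) <= t * psi x + (1 - t) * psi y.
Hypothesis phi_C2 : C2_on (supp phi) phi.
Hypothesis dphi_C2 : C2_on (supp (dual phi)) (dual phi).
Variables z z' : R.
Hypothesis zE : total_integral phi = z%:E.
Hypothesis total_dualE : total_integral (dual phi) = z'%:E.
Local Open Scope ereal_scope.

Let g := asa_density phi.
Let mphi : measurable_fun setT phi := measurable_primal phi_gt0 phi_C2.
Let mg : measurable_fun setT g := measurable_asa_density phi_gt0 phi_C2.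
Let g_gt0 x : (0 < g x)%R := asa_density_gt0 phi_gt0 psi_convex phi_C2 dphi_C2 x.
(* After the substitution [y = grad psi x], the power means for the dual function
   are those of [1 / g] with weight [phi * g]. *)
Let w' x := (phi x * g x)%R.
Let g' x := (g x)^-1%R.

Lemma lebesgue_rV_setT_neq0 : leb setT != 0.
Proof.
have : leb (cube 0 1) <= leb setT.
  by apply: le_measure; rewrite ?inE//; exact: measurable_cube.
rewrite [X in X <= _]lebesgue_cube// expr1n => h.
by rewrite gt_eqF// (lt_le_trans _ h)// lte_fin.
Qed.

Lemma total_integral_dualE :
  total_integral (dual phi) = power_integral leb phi g 1.
Proof.
rewrite -[1%R]subr0 -affine_surface_area_dual// /affine_surface_area.
under [RHS]eq_integral do rewrite powRr0 mulr1.
rewrite /total_integral [RHS]integral_mkcond; apply: eq_integral => y _.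
rewrite patchE; case: ifPn => // /negP ny; congr EFin; apply/le_anti.
rewrite leNgt; apply/andP; split; first by apply/negP => y0; apply: ny; rewrite inE.
apply: lb_le_inf; first by exists (expR (- dotrV y 0) / phi 0)%R, 0%R.
by move=> _ [x _ <-]; rewrite divr_ge0 ?expR_ge0// ltW.
Qed.

Let intE : \int[leb]_x (phi x)%:E = z%:E := zE.

Let z_gt0 : (0 < z)%R.
Proof. by rewrite -lte_fin -intE; apply: integral_gt0 => //; exact: lebesgue_rV_setT_neq0. Qed.

Let N1 : power_integral leb phi g 1 = z'%:E.
Proof. by rewrite -total_integral_dualE. Qed.

Let z'E : \int[leb]_x (w' x)%:E = z'%:E.
Proof. by rewrite -N1; apply: eq_integral => x _; rewrite powRr1// ltW. Qed.

Let w'_gt0 x : (0 < w' x)%R. Proof. exact: mulr_gt0. Qed.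
Let g'_gt0 x : (0 < g' x)%R. Proof. by rewrite invr_gt0. Qed.
Let mw' : measurable_fun setT w'. Proof. exact: measurable_funM. Qed.
Let mg' : measurable_fun setT g'.
Proof.
rewrite (_ : g' = (fun a : R => (a `^ (-1))%R) \o g); last first.
  by apply/funext => x; rewrite /= powR_inv1// ltW.
by apply: measurableT_comp => //; exact: measurable_powR.
Qed.

Let z'_gt0 : (0 < z')%R.
Proof. by rewrite -lte_fin -z'E; apply: integral_gt0 => //; exact: lebesgue_rV_setT_neq0. Qed.

Lemma power_integral_conjugate l :
  power_integral leb w' g' l = power_integral leb phi g (1 - l).
Proof.
apply: eq_integral => x _; rewrite /w' /g'; congr EFin; have gx := g_gt0 x.
rewrite powR_expR ?invr_gt0// lnV// powR_expR// mulrBl mul1r expRD lnK// -mulrA.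
by rewrite mulrN.
Qed.

Let dualE l : affine_surface_area l (dual phi) = power_integral leb phi g (1 - l) :=
  affine_surface_area_dual phi_gt0 psi_convex phi_C2 dphi_C2 l.

Let power_meanE l : epow (affine_surface_area l phi / total_integral phi) l^-1 =
  power_mean leb phi g l.
Proof. by rewrite affine_surface_areaE. Qed.

Let power_mean_dualE l :
  epow (affine_surface_area l (dual phi) / total_integral (dual phi)) l^-1 =
  power_mean leb w' g' l.
Proof.
rewrite dualE -power_integral_conjugate /power_mean z'E.
by rewrite total_integral_dualE N1.
Qed.

Let OmegaE : Omega phi = power_mean0 leb phi g.
Proof. by rewrite /Omega; under eq_fun do rewrite power_meanE. Qed.

Let Omega_dualE : Omega (dual phi) = power_mean0 leb w' g'.
Proof. by rewrite /Omega; under eq_fun do rewrite power_mean_dualE. Qed.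

Lemma Omega_le l : (0 < l)%R ->
  Omega phi <= epow (affine_surface_area l phi / total_integral phi) l^-1.
Proof. by move=> l0; rewrite power_meanE OmegaE; exact: power_mean0_le intE _ l0. Qed.

Lemma le_Omega l : (l < 0)%R ->
  epow (affine_surface_area l phi / total_integral phi) l^-1 <= Omega phi.
Proof. by move=> l0; rewrite power_meanE OmegaE; exact: power_mean_le0 intE _ l0. Qed.

(** Bounding both factors by their means of exponent [1], which are reciprocal. *)
Lemma Omega_dual_le1 : Omega phi * Omega (dual phi) <= 1.
Proof.
have zn0 : z != 0%R by rewrite gt_eqF.
have z'n0 : z' != 0%R by rewrite gt_eqF.
have le1 : power_mean0 leb phi g <= (z' / z)%:E.
  have c0 : (0 < z' / z)%R by rewrite divr_gt0.
  have Nc : power_integral leb phi g 1 = (z' / z * z)%:E by rewrite (divfK zn0) N1.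
  have := power_mean0_le mphi mg phi_gt0 g_gt0 z_gt0 intE ltr01.
  by rewrite (power_mean_fin z_gt0 intE c0 Nc) divr1 lnK.
have le1' : power_mean0 leb w' g' <= (z / z')%:E.
  have c0 : (0 < z / z')%R by rewrite divr_gt0.
  have Nc : power_integral leb w' g' 1 = (z / z' * z')%:E.
    by rewrite (divfK z'n0) power_integral_conjugate subrr power_integral0 intE.
  have := power_mean0_le mw' mg' w'_gt0 g'_gt0 z'_gt0 z'E ltr01.
  by rewrite (power_mean_fin z'_gt0 z'E c0 Nc) divr1 lnK.
rewrite OmegaE Omega_dualE.
have -> : 1 = (z' / z)%:E * (z / z')%:E.
  by rewrite -EFinM mulrA (divfK zn0) (divff z'n0).
apply: lee_pmul le1 le1'.
  by have := power_mean0_ge0 mphi mg phi_gt0 g_gt0 z_gt0 intE.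
by have := power_mean0_ge0 mw' mg' w'_gt0 g'_gt0 z'_gt0 z'E.
Qed.

Lemma cvg_Omega_dual :
  (\forall a \near (1%R : R)^', affine_surface_area a (dual phi) < +oo) ->
  epow (affine_surface_area a (dual phi) / total_integral phi) (1 - a)^-1
    @[a --> (1%R : R)^'] --> Omega phi.
Proof.
move=> fin1.
have fin0 : \forall l \near (0%R : R)^', power_integral leb phi g l < +oo.
  apply: (near_onem_dnbhs _ fin1) => l; rewrite dualE.
  by rewrite subKr.
have cv := cvg_power_mean_dnbhs mphi mg phi_gt0 g_gt0 z_gt0 intE fin0.
rewrite OmegaE.
have -> : (fun a => epow (affine_surface_area a (dual phi) / total_integral phi) (1 - a)^-1)
    = power_mean leb phi g \o (fun a => 1 - a)%R.
  by apply/funext => a; rewrite dualE.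
exact: cvg_comp (@cvg_onem_dnbhs0 R) cv.
Qed.

(** All power means of a constant density are equal to it, and those of the dual
    function to its inverse. *)
Lemma Omega_constant_density k : (0 < k)%R -> (forall x, g x = k) ->
  (forall l : R, l != 0%R ->
    Omega phi = epow (affine_surface_area l phi / total_integral phi) l^-1) /\
  Omega phi * Omega (dual phi) = 1.
Proof.
move=> k0 gk.
have Ok := power_mean0_cst mphi mg phi_gt0 g_gt0 z_gt0 intE k0 gk.
have kV : (0 < k^-1)%R by rewrite invr_gt0.
have gk' x : g' x = (k^-1)%R by rewrite /g' gk.
have Ok' := power_mean0_cst mw' mg' w'_gt0 g'_gt0 z'_gt0 z'E kV gk'.
have kk : (k * k^-1 = 1)%R := divff (lt0r_neq0 k0).
split=> [l l0|]; last by rewrite OmegaE Omega_dualE Ok Ok' -EFinM kk.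
rewrite OmegaE Ok power_meanE.
by have -> := power_mean_cst mphi phi_gt0 z_gt0 intE k0 gk l0.
Qed.

End omega.

(** * Gaussians and the main result *)

(** For the Gaussian potential [<x A, x> - ln C] the gradient is [2 x A] and the
    Hessian [2 A], so the density is constant. *)
Lemma gaussian_density (R : realType) n (phi : 'rV[R]_n -> R) (C : R) (A : 'M[R]_n) :
  0 < C -> posdef A -> (forall x, phi x = C * expR (- dotrV (x *m A) x)) ->
  C2_on (supp phi) phi ->
  forall x, asa_density phi x = expR (- 2 * ln C) * \det (2 *: A).
Proof.
move=> C0 [AT A0] phiE phi_C2 x.
have phi_gt0 y : 0 < phi y by rewrite phiE mulr_gt0 ?expR_gt0.
pose psi y := - ln (phi y).
have psiE y : psi y = dotrV (y *m A) y - ln C.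
  by rewrite /psi phiE lnM ?posrE ?expR_gt0// expRK opprD opprK addrC.
have dpsi y : differentiable psi y.
  by have [df _ _] := phi_C2 y (phi_gt0 y); exact: differentiable_Nln.
have Asym v w : dotrV (v *m A) w = dotrV (w *m A) v.
  by rewrite [LHS]dotrVC /dotrV trmx_mul AT mulmxA.
have AA0 v : 0 <= dotrV (v *m A) v.
  have [->|/A0/ltW//] := eqVneq v 0.
  by rewrite mul0mx dotrV_ge0.
(* the quadratic term of the increment is nonnegative, so the linear term bounds
   the increment from below *)
have gradE y : grad psi y = y *m (2 *: A).
  apply/esym/dotrV_le_inj => v; apply: (ge_directional (@ltr01 R) (dpsi y)) => s /andP[s0 _].
  rewrite !psiE mulmxDl dotrVDl !dotrVDr -scalemxAl !dotrVZl !dotrVZr (Asym v y).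
  rewrite -scalemxAr dotrVZl.
  have := mulr_ge0 (ltW s0) (mulr_ge0 (ltW s0) (AA0 v)); lra.
have hessE y : hess psi y = 2 *: A.
  apply/matrixP => i j.
  have dj : differentiable (partial j psi) y.
    by apply: differentiable_partial_Nln => //; exact: phi_gt0.
  have pE z : partial j psi z = (z *m (2 *: A)) ord0 j by rewrite -gradE mxE.
  have slope s : partial j psi (y + s *: delta_mx ord0 i) - partial j psi y =
      s * (2 *: A) i j.
    have incr (z w : 'rV[R]_n) : (z + w) ord0 j - z ord0 j = w ord0 j.
      by rewrite mxE [X in X - _]addrC addrK.
    by rewrite !pE mulmxDl incr -scalemxAl -rowE !mxE.
  have -> : hess psi y i j = grad (partial j psi) y ord0 i by rewrite !mxE.
  rewrite -dotrV_delta; apply/le_anti/andP; split.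
    by apply: (le_directional (@ltr01 R) dj) => s _; rewrite slope.
  by apply: (ge_directional (@ltr01 R) dj) => s _; rewrite slope.
have [df _ _] := phi_C2 x (phi_gt0 x).
rewrite (asa_densityE phi_gt0 phi_C2) -/psi -/(psi x) hessE gradE psiE.
by congr (expR _ * _); rewrite -scalemxAr dotrVZl; ring.
Qed.

Theorem corollary16 (R : realType) (n : nat) (phi : 'rV[R]_n -> R)
  (phi_lc : log_concave phi)
  (phi_sc : strictly_convex (fun x => - ln (phi x)))
  (phi_int : (lebesgue_rV R n).-integrable [set: 'rV[R]_n] (EFin \o phi))
  (dphi_int : (lebesgue_rV R n).-integrable [set: 'rV[R]_n] (EFin \o dual phi))
  (phi_C2 : C2_on (supp phi) phi)
  (dphi_C2 : C2_on (supp (dual phi)) (dual phi)) :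
  [/\ (* (i) *)
      (forall l : R, 0 < l ->
        (Omega phi <=
           epow (affine_surface_area l phi / total_integral phi) l^-1)%E) /\
      (forall l : R, l < 0 ->
        (epow (affine_surface_area l phi / total_integral phi) l^-1
           <= Omega phi)%E),
      (* (ii) *)
      (Omega phi * Omega (dual phi) <= 1)%E,
      (* (iii) *)
      (\forall a \near (1 : R)^', (affine_surface_area a (dual phi) < +oo)%E) ->
      epow (affine_surface_area a (dual phi) / total_integral phi)%E (1 - a)^-1
        @[a --> (1 : R)^'] --> Omega phi &
      (* equality case *)
      forall (C : R) (A : 'M[R]_n), 0 < C -> posdef A ->
        (forall x, phi x = C * expR (- dotrV (x *m A) x)) ->
        (forall l : R, l != 0 ->
           Omega phi =
             epow (affine_surface_area l phi / total_integral phi)%E l^-1) /\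
        (Omega phi * Omega (dual phi) = 1)%E].
Proof.
have phi_gt0 x : 0 < phi x by have [psi [_ ->]] := phi_lc; exact: expR_gt0.
have psi_convex x y t : 0 < t < 1 -> - ln (phi (t *: x + (1 - t) *: y)) <=
    t * - ln (phi x) + (1 - t) * - ln (phi y).
  move=> t01; have [<-|xy] := eqVneq x y; last exact: ltW (phi_sc x y t xy t01).
  by rewrite -scalerDl subrKC scale1r -mulrDl subrKC mul1r.
have [z zE] : exists z, total_integral phi = z%:E.
  by exists (fine (total_integral phi)); rewrite fineK//; exact: integrable_fin_num.
have [z' z'E] : exists z, total_integral (dual phi) = z%:E.
  by exists (fine (total_integral (dual phi))); rewrite fineK//; exact: integrable_fin_num.
split.
- split=> l l0; first exact: (Omega_le phi_gt0 psi_convex phi_C2 dphi_C2 zE).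
  exact: (le_Omega phi_gt0 psi_convex phi_C2 dphi_C2 zE).
- exact: (Omega_dual_le1 phi_gt0 psi_convex phi_C2 dphi_C2 zE z'E).
- exact: (cvg_Omega_dual phi_gt0 psi_convex phi_C2 dphi_C2 zE).
move=> C A C0 A0 phiE.
have gE := gaussian_density C0 A0 phiE phi_C2.
apply: (Omega_constant_density phi_gt0 psi_convex phi_C2 dphi_C2 zE z'E _ gE).
by rewrite -(gE 0); exact: asa_density_gt0.
Qed.
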